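(* Let $G$ be a group (written additively), $k$ a field and $\chi:G\to k^\times$ a character. Taking orbit categories $?/G$ and smash products $?\#G$, which are mutually quasi-inverse biequivalences between the 2-category of $G$-equivariant categories and the 2-category of $G$-hom-graded categories (Asashiba), restrict to mutually quasi-inverse biequivalences of 2-groupoids $$?/G:\ G\text{-}\mathbb S^\chi\mathbf{Cat}_{2,0}\ \rightleftarrows\ \mathbb S^\chi\mathbf{Cat}^G_{2,0}\ :?\#G$$ between the 2-groupoid of $G$-equivariant categories with $\chi$-equivariant Serre structures and the 2-groupoid of $G$-hom-graded categories with $\chi$-hom-graded Serre structures.
   Context: All categories and functors are $k$-linear; $V^*=\mathrm{Hom}_k(V,k)$, and $(V^* )^g=(V^{-g})^*$ for graded $V$. For a 2-category, the subscript $2,0$ denotes its maximal sub-2-groupoid (only 1-cells that are equivalences and invertible 2-cells). 2-category of $G$-equivariant categories: objects $(\mathcal D,F)$ with $F:G\to\mathrm{Autom}(\mathcal D)$, $p\mapsto F^p$, a group homomorphism; 1-cells $(\Phi,\phi):(\mathcal D_1,F_1)\to(\mathcal D_2,F_2)$ with $\Phi$ a functor and natural isomorphisms $\phi^p:\Phi F_1^p\to F_2^p\Phi$ satisfying $\phi^{p+q}=F_2^p\phi^q\circ\phi^pF_1^q$; 2-cells $(\Phi,\phi)\to(\Psi,\psi)$ are natural transformations $\alpha$ with $\psi^p\circ\alpha F_1^p=F_2^p\alpha\circ\phi^p$. 2-category of $G$-hom-graded categories: objects are categories with $G$-graded hom spaces $\mathcal C(x,y)=\bigoplus_p\mathcal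 C^p(x,y)$ and degree-additive composition; 1-cells $(H,\gamma)$ with $H$ a functor and $\gamma:\mathrm{ob}\,\mathcal C_1\to G$ with $\deg(Hf)=\deg f+\gamma(y)-\gamma(x)$ for homogeneous $f:x\to y$; 2-cells $(H,\gamma)\to(I,\delta)$ are natural transformations with $\theta_x$ homogeneous of degree $\delta(x)-\gamma(x)$. Orbit 2-functor: $\mathcal D/G$ has the objects of $\mathcal D$, $(\mathcal D/G)^p(x,y)=\mathcal D(x,F^py)$, the composite of $f$ of degree $p$ and $g$ being $F^p(g)\circ f$; $(\Phi,\phi)/G$ is $\Phi$ on objects with zero degree adjuster, sending $f:x\to F^py$ to $\phi^p_y\circ\Phi f$; on 2-cells it is the identity assignment. Smash product 2-functor: $\mathcal C\#G$ has objects $x^p$ ($x\in\mathcal C,p\in G$), $\mathcal C\#G(x^p,y^q)=\mathcal C^{q-p}(x,y)$, $F^r(x^p)=x^{p+r}$; $(H,\gamma)\#G$ sends $x^p$ to $(Hx)^{p+\gamma(x)}$ and acts as $H$ on morphisms (strictly equivariant); $(\theta\#G)_{x^p}=\theta_x$. Serre structure on $\mathcal D$: $(\mathbb S,\kappa)$, $\mathbb S$ an autoequivalence, isomorphisms $\kappa_{x,y}:\mathcal D(x,y)\to\mathcal D(y,\mathbb Sx)^*$ (finite-dimensional homs) with $\kappa(hg)(u)=\kappa(g)(uh)$, $\kappa(gf)(u)=\kappa(g)(\mathbb S(f)u)$. For an automorphism $E$, $\zeta_E:\mathbb SE\to E\mathbb S$ is characterised by $\kappa_{Ey,x}(e)(u)=\kappa_{y,E^{-1}x}(E^{-1}e)(E^{-1}(\zeta_{E,y}u))$.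 A $\chi$-equivariant Serre structure on $(\mathcal D,F)$ is $(\mathbb S,s,\kappa)$ with $(\mathbb S,\kappa)$ a Serre structure and $s^p=\chi(p)\zeta_{F^p}$. A $\chi$-hom-graded Serre structure on $\mathcal C$ (with finite-dimensional graded pieces) is $(\mathbb S,\ell,\kappa)$ with $(\mathbb S,\ell)$ a degree-preserving autoequivalence and isomorphisms $\kappa_{x,y}:\mathcal C(x,y)\to\mathcal C(y,\mathbb Sx)^*$ with $\kappa(hg)(u)=\chi(\deg h)\kappa(g)(uh)$, $\kappa(gf)(u)=\kappa(g)(\mathbb S(f)u)$ for homogeneous morphisms, restricting to $\mathcal C^p(x,y)\cong(\mathcal C^{\ell(x)-p}(y,\mathbb Sx))^*$. The 2-groupoids $G\text{-}\mathbb S^\chi\mathbf{Cat}_{2,0}$ and $\mathbb S^\chi\mathbf{Cat}^G_{2,0}$ are identified (up to biequivalence) with the full sub-2-groupoids, of the maximal sub-2-groupoids of the 2-categories above, on the objects which admit a $\chi$-equivariant, respectively $\chi$-hom-graded, Serre structure.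
   Formalization: The group G is taken to be abelian: for non-abelian G the given formulas are ill-defined, e.g. F^r(x^p)=x^{p+r} does not satisfy F^{r+s}=F^rF^s on the smash product, and degrees in the smash product do not add under composition. *)

(* Defs.v *)
From mathcomp Require Import all_boot all_algebra.
From mathcomp Require Import boolp.

Set Implicit Arguments.
Unset Strict Implicit.
Unset Printing Implicit Defensive.

Import GRing.Theory.
Local Open Scope ring_scope.

Reserved Notation "g ∘ f" (at level 40, left associativity).
Reserved Notation "g ⊚ f" (at level 40, left associativity).
Reserved Notation "b • a" (at level 45, left associativity).
Reserved Notation "h ◃ a" (at level 38, right associativity).
Reserved Notation "b ▹ f" (at level 37, left associativity).

(* A 2-category is treated as a bicategory.  In the 2-categories below the
   1-cells compose associatively and unitally up to extensional equality, and
   the associators and unitors have identity components; recording them avoids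
   transporting 2-cells along equalities of 1-cells.  The conventions are those
   of Johnson and Yau: [g ⊚ f] is g after f, [b • a] is b after a vertically,
   [h ◃ a] and [b ▹ f] are the two whiskerings. *)
Record bicat := Bicat {
  cell0 :> Type;
  cell1 : cell0 -> cell0 -> Type;
  cell2 : forall x y, cell1 x y -> cell1 x y -> Type;
  id1 : forall x, cell1 x x;
  comp1 : forall x y z, cell1 y z -> cell1 x y -> cell1 x z;
  id2 : forall x y (f : cell1 x y), cell2 f f;
  vcomp : forall x y (f g h : cell1 x y), cell2 g h -> cell2 f g -> cell2 f h;
  lwhisk : forall x y z (h : cell1 y z) (f g : cell1 x y),
    cell2 f g -> cell2 (comp1 h f) (comp1 h g);
  rwhisk : forall x y z (g h : cell1 y z),
    cell2 g h -> forall f : cell1 x y, cell2 (comp1 g f) (comp1 h f);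
  assoc : forall w x y z (h : cell1 y z) (g : cell1 x y) (f : cell1 w x),
    cell2 (comp1 (comp1 h g) f) (comp1 h (comp1 g f));
  associ : forall w x y z (h : cell1 y z) (g : cell1 x y) (f : cell1 w x),
    cell2 (comp1 h (comp1 g f)) (comp1 (comp1 h g) f);
  lunit : forall x y (f : cell1 x y), cell2 (comp1 (id1 y) f) f;
  luniti : forall x y (f : cell1 x y), cell2 f (comp1 (id1 y) f);
  runit : forall x y (f : cell1 x y), cell2 (comp1 f (id1 x)) f;
  runiti : forall x y (f : cell1 x y), cell2 f (comp1 f (id1 x));
  vcompA : forall x y (f g h i : cell1 x y)
    (c : cell2 h i) (b : cell2 g h) (a : cell2 f g),
    vcomp c (vcomp b a) = vcomp (vcomp c b) a;
  vcomp1l : forall x y (f g : cell1 x y) (a : cell2 f g), vcomp (id2 g) a = a;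
  vcomp1r : forall x y (f g : cell1 x y) (a : cell2 f g), vcomp a (id2 f) = a;
  lwhisk1 : forall x y z (h : cell1 y z) (f : cell1 x y),
    lwhisk h (id2 f) = id2 (comp1 h f);
  lwhiskM : forall x y z (h : cell1 y z) (f g i : cell1 x y)
    (b : cell2 g i) (a : cell2 f g),
    lwhisk h (vcomp b a) = vcomp (lwhisk h b) (lwhisk h a);
  rwhisk1 : forall x y z (h : cell1 y z) (f : cell1 x y),
    rwhisk (id2 h) f = id2 (comp1 h f);
  rwhiskM : forall x y z (g h i : cell1 y z) (f : cell1 x y)
    (b : cell2 h i) (a : cell2 g h),
    rwhisk (vcomp b a) f = vcomp (rwhisk b f) (rwhisk a f);
  interchange : forall x y z (h k : cell1 y z) (f g : cell1 x y)
    (b : cell2 h k) (a : cell2 f g),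
    vcomp (rwhisk b g) (lwhisk h a) = vcomp (lwhisk k a) (rwhisk b f);
  assocK : forall w x y z (h : cell1 y z) (g : cell1 x y) (f : cell1 w x),
    vcomp (associ h g f) (assoc h g f) = id2 _;
  associK : forall w x y z (h : cell1 y z) (g : cell1 x y) (f : cell1 w x),
    vcomp (assoc h g f) (associ h g f) = id2 _;
  lunitK : forall x y (f : cell1 x y), vcomp (luniti f) (lunit f) = id2 _;
  lunitiK : forall x y (f : cell1 x y), vcomp (lunit f) (luniti f) = id2 _;
  runitK : forall x y (f : cell1 x y), vcomp (runiti f) (runit f) = id2 _;
  runitiK : forall x y (f : cell1 x y), vcomp (runit f) (runiti f) = id2 _;
  lunit_nat : forall x y (f g : cell1 x y) (a : cell2 f g),
    vcomp (lunit g) (lwhisk (id1 y) a) = vcomp a (lunit f);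
  runit_nat : forall x y (f g : cell1 x y) (a : cell2 f g),
    vcomp (runit g) (rwhisk a (id1 x)) = vcomp a (runit f);
  assoc_natr : forall w x y z (h : cell1 y z) (g : cell1 x y)
    (f f' : cell1 w x) (a : cell2 f f'),
    vcomp (assoc h g f') (lwhisk (comp1 h g) a)
    = vcomp (lwhisk h (lwhisk g a)) (assoc h g f);
  assoc_natm : forall w x y z (h : cell1 y z) (g g' : cell1 x y)
    (b : cell2 g g') (f : cell1 w x),
    vcomp (assoc h g' f) (rwhisk (lwhisk h b) f)
    = vcomp (lwhisk h (rwhisk b f)) (assoc h g f);
  assoc_natl : forall w x y z (h h' : cell1 y z) (c : cell2 h h')
    (g : cell1 x y) (f : cell1 w x),
    vcomp (assoc h' g f) (rwhisk (rwhisk c g) f)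
    = vcomp (rwhisk c (comp1 g f)) (assoc h g f);
  pentagon : forall v w x y z (i : cell1 y z) (h : cell1 x y) (g : cell1 w x)
    (f : cell1 v w),
    vcomp (assoc i h (comp1 g f)) (assoc (comp1 i h) g f)
    = vcomp (vcomp (lwhisk i (assoc h g f)) (assoc i (comp1 h g) f))
        (rwhisk (assoc i h g) f);
  triangle : forall x y z (g : cell1 y z) (f : cell1 x y),
    vcomp (lwhisk g (lunit f)) (assoc g (id1 y) f) = rwhisk (runit g) f
}.

Arguments cell2 {_ _ _}.
Arguments id1 {_}.
Arguments comp1 {_ _ _ _}.
Arguments id2 {_ _ _}.
Arguments vcomp {_ _ _ _ _ _}.
Arguments lwhisk {_ _ _ _} _ {_ _}.
Arguments rwhisk {_ _ _ _ _ _}.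
Arguments assoc {_ _ _ _ _}.
Arguments associ {_ _ _ _ _}.
Arguments lunit {_ _ _}.
Arguments luniti {_ _ _}.
Arguments runit {_ _ _}.
Arguments runiti {_ _ _}.

Notation "g ⊚ f" := (comp1 g f).
Notation "b • a" := (vcomp b a).
Notation "h ◃ a" := (lwhisk h a).
Notation "b ▹ f" := (rwhisk b f).

Section Invertibility.
Variable B : bicat.
Implicit Types x y z : B.

Definition inverse2 x y (f g : cell1 x y) (a : cell2 f g) (b : cell2 g f) :=
  b • a = id2 f /\ a • b = id2 g.

Definition invertible2 x y (f g : cell1 x y) (a : cell2 f g) :=
  exists b, inverse2 a b.

Definition is_equivalence x y (f : cell1 x y) :=
  exists g : cell1 y x,
    (exists a : cell2 (id1 x) (g ⊚ f), invertible2 a) /\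
    (exists b : cell2 (f ⊚ g) (id1 y), invertible2 b).

Lemma invertible2_id x y (f : cell1 x y) : invertible2 (id2 f).
Proof. by exists (id2 f); split; rewrite vcomp1l. Qed.

Lemma invertible2_vcomp x y (f g h : cell1 x y) (b : cell2 g h)
  (a : cell2 f g) : invertible2 b -> invertible2 a -> invertible2 (b • a).
Proof.
move=> [b' [b1 b2]] [a' [a1 a2]]; exists (a' • b'); split.
  by rewrite vcompA -(vcompA a') b1 vcomp1r.
by rewrite vcompA -(vcompA b) a2 vcomp1r.
Qed.

Lemma invertible2_lwhisk x y z (h : cell1 y z) (f g : cell1 x y)
  (a : cell2 f g) : invertible2 a -> invertible2 (h ◃ a).
Proof.
by move=> [b [b1 b2]]; exists (h ◃ b); split; rewrite -lwhiskM ?b1 ?b2 lwhisk1.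
Qed.

Lemma invertible2_rwhisk x y z (h k : cell1 y z) (b : cell2 h k)
  (f : cell1 x y) : invertible2 b -> invertible2 (b ▹ f).
Proof.
by move=> [a [a1 a2]]; exists (a ▹ f); split; rewrite -rwhiskM ?a1 ?a2 rwhisk1.
Qed.

Lemma invertible2_assoc w x y z (h : cell1 y z) (g : cell1 x y)
  (f : cell1 w x) : invertible2 (assoc h g f).
Proof. by exists (associ h g f); split; rewrite ?assocK ?associK. Qed.

Lemma invertible2_associ w x y z (h : cell1 y z) (g : cell1 x y)
  (f : cell1 w x) : invertible2 (associ h g f).
Proof. by exists (assoc h g f); split; rewrite ?assocK ?associK. Qed.

Lemma invertible2_lunit x y (f : cell1 x y) : invertible2 (lunit f).
Proof. by exists (luniti f); split; rewrite ?lunitK ?lunitiK. Qed.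

Lemma invertible2_luniti x y (f : cell1 x y) : invertible2 (luniti f).
Proof. by exists (lunit f); split; rewrite ?lunitK ?lunitiK. Qed.

Lemma invertible2_runit x y (f : cell1 x y) : invertible2 (runit f).
Proof. by exists (runiti f); split; rewrite ?runitK ?runitiK. Qed.

Lemma invertible2_runiti x y (f : cell1 x y) : invertible2 (runiti f).
Proof. by exists (runit f); split; rewrite ?runitK ?runitiK. Qed.

#[local] Hint Resolve invertible2_id invertible2_vcomp invertible2_lwhisk
  invertible2_rwhisk invertible2_assoc invertible2_associ invertible2_lunit
  invertible2_luniti invertible2_runit invertible2_runiti : core.

Lemma is_equivalence_id x : is_equivalence (id1 x).
Proof.
by exists (id1 x); split; [exists (luniti _) | exists (lunit _)].
Qed.

Lemma is_equivalence_comp x y z (g : cell1 y z) (f : cell1 x y) :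
  is_equivalence g -> is_equivalence f -> is_equivalence (g ⊚ f).
Proof.
move=> [g' [[a ia] [b ib]]] [f' [[c ic] [d jd]]]; exists (f' ⊚ g'); split.
  exists (associ f' g' (g ⊚ f)
          • (f' ◃ (assoc g' g f • ((a ▹ f) • luniti f))) • c).
  by auto 10.
exists (b • ((g ◃ ((lunit g' • (d ▹ g')) • associ f f' g'))
             • assoc g f (f' ⊚ g'))).
by auto 10.
Qed.

End Invertibility.

Lemma sval_eq T (P : T -> Prop) (u v : {x | P x}) : sval u = sval v -> u = v.
Proof. by case: u v => [x p] [y q]; exact: eq_exist. Qed.

Section MaxTwoGroupoid.
Variable B : bicat.

Definition max_cell1 (x y : B) := {f : cell1 x y | is_equivalence f}.

Definition max_cell2 (x y : B) (f g : max_cell1 x y) :=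
  {a : cell2 (sval f) (sval g) | invertible2 a}.

Definition max_2groupoid : bicat.
Proof.
refine (@Bicat B max_cell1 max_cell2
  (fun x => exist _ (id1 x) (is_equivalence_id x))
  (fun x y z g f => exist _ (sval g ⊚ sval f)
     (is_equivalence_comp (svalP g) (svalP f)))
  (fun x y f => exist _ (id2 (sval f)) (invertible2_id (sval f)))
  (fun x y f g h b a => exist _ (sval b • sval a)
     (invertible2_vcomp (svalP b) (svalP a)))
  (fun x y z h f g a => exist _ (sval h ◃ sval a)
     (invertible2_lwhisk (sval h) (svalP a)))
  (fun x y z g h b f => exist _ (sval b ▹ sval f)
     (invertible2_rwhisk (sval f) (svalP b)))
  (fun w x y z h g f => exist _ (assoc (sval h) (sval g) (sval f))
     (invertible2_assoc _ _ _))
  (fun w x y z h g f => exist _ (associ (sval h) (sval g) (sval f))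
     (invertible2_associ _ _ _))
  (fun x y f => exist _ (lunit (sval f)) (invertible2_lunit _))
  (fun x y f => exist _ (luniti (sval f)) (invertible2_luniti _))
  (fun x y f => exist _ (runit (sval f)) (invertible2_runit _))
  (fun x y f => exist _ (runiti (sval f)) (invertible2_runiti _))
  _ _ _ _ _ _ _ _ _ _ _ _ _ _ _ _ _ _ _ _ _); move=> *;
  apply: sval_eq => /=.
- exact: vcompA. - exact: vcomp1l. - exact: vcomp1r. - exact: lwhisk1.
- exact: lwhiskM. - exact: rwhisk1. - exact: rwhiskM. - exact: interchange.
- exact: assocK. - exact: associK. - exact: lunitK. - exact: lunitiK.
- exact: runitK. - exact: runitiK. - exact: lunit_nat. - exact: runit_nat.
- exact: assoc_natr. - exact: assoc_natm. - exact: assoc_natl.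
- exact: pentagon. - exact: triangle.
Defined.

End MaxTwoGroupoid.

Definition full_sub (B : bicat) (A : B -> Prop) : bicat.
Proof.
refine (@Bicat {x : B | A x}
  (fun x y => cell1 (sval x) (sval y))
  (fun x y f g => cell2 f g)
  (fun x => id1 (sval x))
  (fun x y z g f => g ⊚ f)
  (fun x y f => id2 f)
  (fun x y f g h b a => b • a)
  (fun x y z h f g a => h ◃ a)
  (fun x y z g h b f => b ▹ f)
  (fun w x y z h g f => assoc h g f)
  (fun w x y z h g f => associ h g f)
  (fun x y f => lunit f) (fun x y f => luniti f)
  (fun x y f => runit f) (fun x y f => runiti f)
  _ _ _ _ _ _ _ _ _ _ _ _ _ _ _ _ _ _ _ _ _); move=> *.
- exact: vcompA. - exact: vcomp1l. - exact: vcomp1r. - exact: lwhisk1.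
- exact: lwhiskM. - exact: rwhisk1. - exact: rwhiskM. - exact: interchange.
- exact: assocK. - exact: associK. - exact: lunitK. - exact: lunitiK.
- exact: runitK. - exact: runitiK. - exact: lunit_nat. - exact: runit_nat.
- exact: assoc_natr. - exact: assoc_natm. - exact: assoc_natl.
- exact: pentagon. - exact: triangle.
Defined.

Record pseudofunctor (B C : bicat) := Pseudofunctor {
  pf0 :> B -> C;
  pf1 : forall x y, cell1 x y -> cell1 (pf0 x) (pf0 y);
  pf2 : forall x y (f g : cell1 x y), cell2 f g -> cell2 (pf1 f) (pf1 g);
  pf_unit : forall x, cell2 (id1 (pf0 x)) (pf1 (id1 x));
  pf_comp : forall x y z (g : cell1 y z) (f : cell1 x y),
    cell2 (pf1 g ⊚ pf1 f) (pf1 (g ⊚ f));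
  pf_unit_inv : forall x, invertible2 (pf_unit x);
  pf_comp_inv : forall x y z (g : cell1 y z) (f : cell1 x y),
    invertible2 (pf_comp g f);
  pf2_id : forall x y (f : cell1 x y), pf2 (id2 f) = id2 (pf1 f);
  pf2_vcomp : forall x y (f g h : cell1 x y) (b : cell2 g h) (a : cell2 f g),
    pf2 (b • a) = pf2 b • pf2 a;
  pf_comp_natl : forall x y z (h : cell1 y z) (f g : cell1 x y)
    (a : cell2 f g),
    pf2 (h ◃ a) • pf_comp h f = pf_comp h g • (pf1 h ◃ pf2 a);
  pf_comp_natr : forall x y z (g h : cell1 y z) (b : cell2 g h)
    (f : cell1 x y),
    pf2 (b ▹ f) • pf_comp g f = pf_comp h f • (pf2 b ▹ pf1 f);
  pf_assoc : forall w x y z (h : cell1 y z) (g : cell1 x y) (f : cell1 w x),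
    pf_comp h (g ⊚ f) • (pf1 h ◃ pf_comp g f)
      • assoc (pf1 h) (pf1 g) (pf1 f)
    = pf2 (assoc h g f) • pf_comp (h ⊚ g) f • (pf_comp h g ▹ pf1 f);
  pf_lunit : forall x y (f : cell1 x y),
    pf2 (lunit f) • pf_comp (id1 y) f • (pf_unit y ▹ pf1 f) = lunit (pf1 f);
  pf_runit : forall x y (f : cell1 x y),
    pf2 (runit f) • pf_comp f (id1 x) • (pf1 f ◃ pf_unit x) = runit (pf1 f)
}.

Arguments pf1 {_ _} _ {_ _}.
Arguments pf2 {_ _} _ {_ _ _ _}.
Arguments pf_unit {_ _}.
Arguments pf_comp {_ _} _ {_ _ _}.

Definition pf_id (B : bicat) : pseudofunctor B B.
Proof.
refine (@Pseudofunctor B B id (fun x y f => f) (fun x y f g a => a)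
  (fun x => id2 (id1 x)) (fun x y z g f => id2 (g ⊚ f))
  _ _ _ _ _ _ _ _ _) => * /=;
  rewrite ?lwhisk1 ?rwhisk1 ?vcomp1l ?vcomp1r ?vcomp1l //;
  exact: invertible2_id.
Defined.

Section PseudofunctorInvertible.
Variables (B C : bicat) (P : pseudofunctor B C).

Lemma pf2_invertible2 x y (f g : @cell1 B x y) (a : cell2 f g) :
  invertible2 a -> invertible2 (pf2 P a).
Proof.
by move=> [b [b1 b2]]; exists (pf2 P b); split;
  rewrite -pf2_vcomp ?b1 ?b2 pf2_id.
Qed.

Lemma invertible2_sym (D : bicat) x y (f g : @cell1 D x y)
  (a : cell2 f g) : invertible2 a -> exists b : cell2 g f, invertible2 b.
Proof. by move=> [b [b1 b2]]; exists b; exists a. Qed.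

Lemma pf1_is_equivalence x y (f : @cell1 B x y) :
  is_equivalence f -> is_equivalence (pf1 P f).
Proof.
move=> [g [[a ia] [b ib]]]; exists (pf1 P g); split.
  have [c ic] := invertible2_sym (pf_comp_inv P g f).
  exists (c • pf2 P a • pf_unit P x).
  apply: invertible2_vcomp; last exact: pf_unit_inv.
  by apply: invertible2_vcomp => //; exact: pf2_invertible2.
have [c ic] := invertible2_sym (pf_unit_inv P y).
exists (c • pf2 P b • pf_comp P f g).
apply: invertible2_vcomp; last exact: pf_comp_inv.
by apply: invertible2_vcomp => //; exact: pf2_invertible2.
Qed.

End PseudofunctorInvertible.

Definition pf_compose (B C D : bicat) (Q : pseudofunctor C D)
  (P : pseudofunctor B C) : pseudofunctor B D.
Proof.
refine (@Pseudofunctor B D (fun x => Q (P x)) (fun x y f => pf1 Q (pf1 P f))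
  (fun x y f g a => pf2 Q (pf2 P a))
  (fun x => pf2 Q (pf_unit P x) • pf_unit Q (P x))
  (fun x y z g f => pf2 Q (pf_comp P g f) • pf_comp Q (pf1 P g) (pf1 P f))
  _ _ _ _ _ _ _ _ _).
- move=> x; apply: invertible2_vcomp; last exact: pf_unit_inv.
  by apply/pf2_invertible2/pf_unit_inv.
- move=> x y z g f; apply: invertible2_vcomp; last exact: pf_comp_inv.
  by apply/pf2_invertible2/pf_comp_inv.
- by move=> x y f; rewrite !pf2_id.
- by move=> x y f g h b a; rewrite !pf2_vcomp.
- move=> x y z h f g a.
  by rewrite vcompA -pf2_vcomp pf_comp_natl pf2_vcomp -!vcompA pf_comp_natl.
- move=> x y z g h b f.
  by rewrite vcompA -pf2_vcomp pf_comp_natr pf2_vcomp -!vcompA pf_comp_natr.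
- move=> w x y z h g f; rewrite lwhiskM rwhiskM.
  rewrite -(vcompA (pf2 Q (pf_comp P h (g ⊚ f)))) (vcompA (pf_comp Q _ _)).
  rewrite -pf_comp_natl -!vcompA (vcompA (pf_comp Q _ _)) pf_assoc.
  rewrite !vcompA -!pf2_vcomp pf_assoc !pf2_vcomp -!vcompA.
  by congr (_ • (_ • _)); rewrite !vcompA pf_comp_natr.
- move=> x y f; rewrite rwhiskM -!vcompA (vcompA (pf_comp Q _ _)).
  by rewrite -pf_comp_natr !vcompA -!pf2_vcomp pf_lunit pf_lunit.
- move=> x y f; rewrite lwhiskM -!vcompA (vcompA (pf_comp Q _ _)).
  by rewrite -pf_comp_natl !vcompA -!pf2_vcomp pf_runit pf_runit.
Defined.

Definition pf_max (B C : bicat) (P : pseudofunctor B C) :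
  pseudofunctor (max_2groupoid B) (max_2groupoid C).
Proof.
refine (@Pseudofunctor (max_2groupoid B) (max_2groupoid C) (pf0 P)
  (fun x y f => exist _ (pf1 P (sval f)) (pf1_is_equivalence P (svalP f)))
  (fun x y f g a => exist _ (pf2 P (sval a)) (pf2_invertible2 P (svalP a)))
  (fun x => exist _ (pf_unit P x) (pf_unit_inv P x))
  (fun x y z g f => exist _ (pf_comp P (sval g) (sval f)) (pf_comp_inv P _ _))
  _ _ _ _ _ _ _ _ _).
- move=> x; have [b [b1 b2]] := pf_unit_inv P x.
  by exists (exist _ b (ex_intro _ _ (conj b2 b1))); split; apply: sval_eq.
- move=> x y z g f; have [b [b1 b2]] := pf_comp_inv P (sval g) (sval f).
  by exists (exist _ b (ex_intro _ _ (conj b2 b1))); split; apply: sval_eq.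
- by move=> *; apply: sval_eq; exact: pf2_id.
- by move=> *; apply: sval_eq; exact: pf2_vcomp.
- by move=> *; apply: sval_eq; exact: pf_comp_natl.
- by move=> *; apply: sval_eq; exact: pf_comp_natr.
- by move=> *; apply: sval_eq; exact: pf_assoc.
- by move=> *; apply: sval_eq; exact: pf_lunit.
- by move=> *; apply: sval_eq; exact: pf_runit.
Defined.

Definition pf_full (B C : bicat) (A : B -> Prop) (A' : C -> Prop)
  (P : pseudofunctor B C) (h : forall x, A x -> A' (P x)) :
  pseudofunctor (full_sub A) (full_sub A').
Proof.
refine (@Pseudofunctor (full_sub A) (full_sub A')
  (fun x => exist _ (P (sval x)) (h (sval x) (svalP x)))
  (fun x y f => pf1 P f) (fun x y f g a => pf2 P a)
  (fun x => pf_unit P (sval x)) (fun x y z g f => pf_comp P g f)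
  _ _ _ _ _ _ _ _ _).
- by move=> x; exact: (pf_unit_inv P (sval x)).
- by move=> x y z g f; exact: (pf_comp_inv P g f).
- by move=> *; exact: pf2_id.
- by move=> *; exact: pf2_vcomp.
- by move=> *; exact: pf_comp_natl.
- by move=> *; exact: pf_comp_natr.
- by move=> *; exact: pf_assoc.
- by move=> *; exact: pf_lunit.
- by move=> *; exact: pf_runit.
Defined.

Record pseudonat (B C : bicat) (P Q : pseudofunctor B C) := Pseudonat {
  pn0 :> forall x : B, cell1 (P x) (Q x);
  pn1 : forall (x y : B) (f : cell1 x y),
    cell2 (pf1 Q f ⊚ pn0 x) (pn0 y ⊚ pf1 P f);
  pn1_inv : forall (x y : B) (f : cell1 x y), invertible2 (pn1 f);
  pn_nat : forall (x y : B) (f g : cell1 x y) (a : cell2 f g),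
    (pn0 y ◃ pf2 P a) • pn1 f = pn1 g • (pf2 Q a ▹ pn0 x);
  pn_unit : forall x : B,
    pn1 (id1 x) • (pf_unit Q x ▹ pn0 x)
    = (pn0 x ◃ pf_unit P x) • runiti (pn0 x) • lunit (pn0 x);
  pn_comp : forall (x y z : B) (g : cell1 y z) (f : cell1 x y),
    pn1 (g ⊚ f) • (pf_comp Q g f ▹ pn0 x)
    = (pn0 z ◃ pf_comp P g f) • assoc (pn0 z) (pf1 P g) (pf1 P f)
      • (pn1 g ▹ pf1 P f) • associ (pf1 Q g) (pn0 y) (pf1 P f)
      • (pf1 Q g ◃ pn1 f) • assoc (pf1 Q g) (pf1 Q f) (pn0 x)
}.

(* A pseudonatural equivalence is a pseudonatural transformation each of whose
   components is an equivalence. *)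
Definition pseudonat_equivalent (B C : bicat) (P Q : pseudofunctor B C) :=
  exists s : pseudonat P Q, forall x, is_equivalence (s x).

Definition quasi_inverse_biequivalences (B C : bicat)
  (P : pseudofunctor B C) (Q : pseudofunctor C B) :=
  pseudonat_equivalent (pf_id B) (pf_compose Q P) /\
  pseudonat_equivalent (pf_id C) (pf_compose P Q).

(* A decision procedure for identities between degrees, valid in any abelian
   group: both sides are compared as integer combinations of atoms. *)
Module Degree.
Inductive exp := Var of nat | Zero | Add of exp & exp | Opp of exp.

Section Eval.
Variable V : zmodType.

Fixpoint eval (env : seq V) (e : exp) : V :=
  match e with
  | Var n => nth 0 env n
  | Zero => 0
  | Add a b => eval env a + eval env b
  | Opp a => - eval env a
  end.

Fixpoint coef (e : exp) (i : nat) : int :=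
  match e with
  | Var n => (n == i)%:Z
  | Zero => 0
  | Add a b => coef a i + coef b i
  | Opp a => - coef a i
  end.

Lemma evalE env e :
  eval env e = \sum_(i < size env) nth 0 env i *~ coef e i.
Proof.
elim: e => [n||a IHa b IHb|a IHa] /=.
- have [ltn|len] := ltnP n (size env).
    rewrite (bigD1 (Ordinal ltn)) //= eqxx mulr1z big1 ?addr0 // => i.
    by rewrite -val_eqE eq_sym /= => /negPf ->; rewrite mulr0z.
  rewrite nth_default // big1 // => i _.
  by case: eqP len (ltn_ord i) => [-> | //]; rewrite leqNgt => /negPf ->.
- by rewrite big1 // => i _; rewrite mulr0z.
- by rewrite IHa IHb -big_split; apply: eq_bigr => i _; rewrite mulrzDr.
- by rewrite IHa -sumrN; apply: eq_bigr => i _; rewrite mulrNz.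
Qed.

Lemma correct env a b :
  all (fun i => coef a i == coef b i) (iota 0 (size env)) ->
  eval env a = eval env b.
Proof.
move=> /allP h; rewrite !evalE; apply: eq_bigr => i _.
by rewrite (eqP (h i _)) // mem_iota /=.
Qed.
End Eval.

Ltac mem_env t env :=
  lazymatch env with
  | nil => constr:(false)
  | t :: _ => constr:(true)
  | _ :: ?env' => mem_env t env'
  end.

Ltac index_env t env :=
  lazymatch env with
  | t :: _ => constr:(O)
  | _ :: ?env' => let n := index_env t env' in constr:(S n)
  end.

Ltac atoms t env :=
  lazymatch t with
  | ?a + ?b => let env := atoms a env in atoms b env
  | - ?a => atoms a env
  | 0 => env
  | _ => lazymatch mem_env t env with
         | true => env
         | false => constr:(t :: env)
         end
  end.

Ltac quote_exp t env :=
  lazymatch t with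
  | ?a + ?b => let a := quote_exp a env in let b := quote_exp b env in
               constr:(Add a b)
  | - ?a => let a := quote_exp a env in constr:(Opp a)
  | 0 => constr:(Zero)
  | _ => let n := index_env t env in constr:(Var n)
  end.

Ltac solve :=
  intros; subst; simpl;
  lazymatch goal with
  | |- ?a = ?b :> ?V =>
    let env := atoms a (@nil V) in
    let env := atoms b env in
    let ea := quote_exp a env in
    let eb := quote_exp b env in
    change (eval env ea = eval env eb);
    apply: correct; vm_compute; reflexivity
  end.
End Degree.

Section LinearCategories.
Variable k : fieldType.

Record lincat := LinCat {
  ob :> Type;
  hom : ob -> ob -> lmodType k;
  idm : forall x, hom x x;
  compm : forall x y z, hom y z -> hom x y -> hom x z;
  comp_linearl : forall x y z (f : hom x y),
    linear (fun g : hom y z => compm g f);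
  comp_linearr : forall x y z (g : hom y z),
    linear (fun f : hom x y => compm g f);
  compmA : forall w x y z (h : hom y z) (g : hom x y) (f : hom w x),
    compm h (compm g f) = compm (compm h g) f;
  comp1m : forall x y (f : hom x y), compm (idm y) f = f;
  compm1 : forall x y (f : hom x y), compm f (idm x) = f
}.

Arguments hom {_}.
Arguments idm {_}.
Arguments compm {_ _ _ _}.
Local Notation "g ∘ f" := (compm g f).

Definition is_iso (D : lincat) (x y : D) (f : hom x y) :=
  exists g : hom y x, g ∘ f = idm x /\ f ∘ g = idm y.

(* The identity of x, seen as a morphism from x to an equal object y. *)
Definition eqm (D : lincat) (x y : D) (e : x = y) : hom x y :=
  match e with erefl => idm x end.

Record functor (C D : lincat) := Functor {
  fob :> C -> D;
  fmor : forall x y, hom x y -> hom (fob x) (fob y);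
  fmor_linear : forall x y, linear (@fmor x y);
  fmor1 : forall x, fmor (idm x) = idm (fob x);
  fmorM : forall x y z (g : hom y z) (f : hom x y),
    fmor (g ∘ f) = fmor g ∘ fmor f
}.

Arguments fmor {_ _} _ {_ _}.

Definition fid (D : lincat) : functor D D.
Proof. by refine (@Functor D D id (fun x y f => f) _ _ _). Defined.

Definition fcomp (C D E : lincat) (S : functor D E) (T : functor C D) :
  functor C E.
Proof.
refine (@Functor C E (fun x => S (T x)) (fun x y f => fmor S (fmor T f))
  _ _ _).
- by move=> x y a f g; rewrite !fmor_linear.
- by move=> x; rewrite !fmor1.
- by move=> x y z g f; rewrite !fmorM.
Defined.

Definition feq_ob (C D : lincat) (S T : functor C D) (e : S = T) (x : C) :
  S x = T x := f_equal (fun U : functor C D => U x) e.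

Record nattrans (C D : lincat) (S T : functor C D) := NatTrans {
  ntc :> forall x, hom (S x) (T x);
  nt_nat : forall x y (f : hom x y), ntc y ∘ fmor S f = fmor T f ∘ ntc x
}.

Definition natiso (C D : lincat) (S T : functor C D) :=
  exists a : nattrans S T, forall x, is_iso (a x).

Definition is_autoequivalence (D : lincat) (S : functor D D) :=
  exists T : functor D D,
    natiso (fid D) (fcomp T S) /\ natiso (fcomp S T) (fid D).

Record automorphism (D : lincat) := Automorphism {
  aut :> functor D D;
  autV : functor D D;
  autK : fcomp autV aut = fid D;
  autVK : fcomp aut autV = fid D
}.

Definition autobK (D : lincat) (E : automorphism D) (x : D) :
  autV E (E x) = x := feq_ob (autK E) x.

Definition finite_dim (V : lmodType k) : Prop :=
  exists n, inhabited (Vector.axiom n V).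

(* [serre_kappa f] is a linear form on hom y (S x). *)
Record serre (D : lincat) := Serre {
  serre_fun :> functor D D;
  serre_equiv : is_autoequivalence serre_fun;
  serre_finite : forall x y : D, finite_dim (hom x y);
  serre_kappa : forall x y : D, hom x y -> {scalar hom y (serre_fun x)};
  serre_kappa_linear : forall (x y : D) (a : k) (f g : hom x y) u,
    serre_kappa (a *: f + g) u = a * serre_kappa f u + serre_kappa g u;
  serre_kappa_bij : forall x y : D, bijective (@serre_kappa x y);
  serre_kappal : forall (x y z : D) (h : hom y z) (g : hom x y)
    (u : hom z (serre_fun x)),
    serre_kappa (h ∘ g) u = serre_kappa g (u ∘ h);
  serre_kappar : forall (w x y : D) (g : hom x y) (f : hom w x)
    (u : hom y (serre_fun w)),
    serre_kappa (g ∘ f) u = serre_kappa g (fmor serre_fun f ∘ u)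
}.

Arguments serre_kappa {_} _ {_ _}.

(* Here e : E y -> x and u : x -> S (E y); the identities [eqm] account for
   the equality of E^-1 (E z) with z. *)
Definition is_zeta (D : lincat) (S : serre D) (E : automorphism D)
    (zeta : nattrans (fcomp S E) (fcomp E S)) : Prop :=
  forall (x y : D) (e : hom (E y) x) (u : hom x (S (E y))),
    serre_kappa S e u
    = serre_kappa S (fmor (autV E) e ∘ eqm (esym (autobK E y)))
        (eqm (autobK E (S y)) ∘ fmor (autV E) (zeta y ∘ u)).

Section Equivariant.
Variable G : zmodType.

(* A homomorphism from G to the group of automorphisms of D; an automorphism is
   determined by its underlying functor. *)
Record eqcat := EqCat {
  eqc :> lincat;
  eact : G -> automorphism eqc;
  act0 : eact 0 = fid eqc :> functor eqc eqc;
  actD : forall p q, eact (p + q) = fcomp (eact p) (eact q) :> functor eqc eqc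
}.

(* [eqphiD] is phi^(p+q) = F_2^p phi^q o phi^p F_1^q; the identities [eqm]
   account for the equality of F^(p+q) with F^p F^q on objects. *)
Record eqfun (D1 D2 : eqcat) := EqFun {
  eqf :> functor D1 D2;
  eqphi : forall p, nattrans (fcomp eqf (eact D1 p)) (fcomp (eact D2 p) eqf);
  eqphi_iso : forall p x, is_iso (eqphi p x);
  eqphiD : forall p q x,
    eqm (feq_ob (actD D2 p q) (eqf x)) ∘ eqphi (p + q) x
    = fmor (eact D2 p) (eqphi q x) ∘ eqphi p (eact D1 q x)
      ∘ fmor eqf (eqm (feq_ob (actD D1 p q) x))
}.

Arguments eqphi {_ _}.

Record eqnat (D1 D2 : eqcat) (S T : eqfun D1 D2) := EqNat {
  eqn :> nattrans S T;
  eqn_phi : forall p x,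
    eqphi T p x ∘ eqn (eact D1 p x) = fmor (eact D2 p) (eqn x) ∘ eqphi S p x
}.

Record character := Character {
  chi :> G -> k;
  chi_neq0 : forall p, chi p != 0;
  chiD : forall p q, chi (p + q) = chi p * chi q
}.

Record eqserre (X : character) (D : eqcat) := EqSerre {
  eqserre_serre :> serre D;
  eqserre_s : forall p,
    nattrans (fcomp eqserre_serre (eact D p)) (fcomp (eact D p) eqserre_serre);
  eqserre_zeta : forall p, exists zeta, is_zeta zeta /\
    forall x, eqserre_s p x = X p *: zeta x
}.

Definition admits_eqserre (X : character) (D : eqcat) : Prop :=
  inhabited (eqserre X D).

(* The graded hom space from x to y is given by its homogeneous components
   [ghom x y p], and all structure on homogeneous morphisms only, from which it
   extends additively to the direct sum.  Operations that add degrees take the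
   degree of the result together with a proof that it is the expected one, so
   that the laws need no transport. *)
Record grcat := GrCat {
  gob :> Type;
  ghom : gob -> gob -> G -> lmodType k;
  gid : forall x, ghom x x 0;
  gcomp : forall x y z p q r, p + q = r ->
    ghom y z q -> ghom x y p -> ghom x z r;
  gcomp_linearl : forall x y z p q r (e : p + q = r) (f : ghom x y p),
    linear (fun g : ghom y z q => gcomp e g f);
  gcomp_linearr : forall x y z p q r (e : p + q = r) (g : ghom y z q),
    linear (fun f : ghom x y p => gcomp e g f);
  gcompA : forall w x y z p q r pq qr pqr
    (e1 : p + qr = pqr) (e2 : q + r = qr) (e3 : pq + r = pqr) (e4 : p + q = pq)
    (h : ghom y z r) (g : ghom x y q) (f : ghom w x p),
    gcomp e1 (gcomp e2 h g) f = gcomp e3 h (gcomp e4 g f);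
  gcomp1m : forall x y p (e : p + 0 = p) (f : ghom x y p),
    gcomp e (gid y) f = f;
  gcompm1 : forall x y p (e : 0 + p = p) (f : ghom x y p),
    gcomp e f (gid x) = f
}.

Arguments ghom {_}.
Arguments gid {_}.
Arguments gcomp {_ _ _ _ _ _ _}.

Definition gcast (C : grcat) (x y : C) (p q : G) (e : p = q) :
    ghom x y p -> ghom x y q :=
  match e with erefl => id end.

(* A functor with degree adjuster [gadj]; [gmor e] is its action on morphisms
   of degree p. *)
Record grfun (C1 C2 : grcat) := GrFun {
  gfob :> C1 -> C2;
  gadj : C1 -> G;
  gmor : forall x y p q, p + gadj y - gadj x = q ->
    ghom x y p -> ghom (gfob x) (gfob y) q;
  gmor_linear : forall x y p q (e : p + gadj y - gadj x = q),
    linear (gmor e);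
  gmor1 : forall x (e : 0 + gadj x - gadj x = 0), gmor e (gid x) = gid (gfob x);
  gmorM : forall x y z p q r p' q' r' (e : p + q = r) (e' : p' + q' = r')
    (ep : p + gadj y - gadj x = p') (eq : q + gadj z - gadj y = q')
    (er : r + gadj z - gadj x = r') (g : ghom y z q) (f : ghom x y p),
    gmor er (gcomp e g f) = gcomp e' (gmor eq g) (gmor ep f)
}.

Arguments gadj {_ _}.
Arguments gmor {_ _} _ {_ _ _ _}.

Record grnat (C1 C2 : grcat) (H I : grfun C1 C2) := GrNat {
  gnt :> forall x, ghom (H x) (I x) (gadj I x - gadj H x);
  gnt_nat : forall x y p pH pI r
    (eH : p + gadj H y - gadj H x = pH) (eI : p + gadj I y - gadj I x = pI)
    (e1 : gadj I x - gadj H x + pI = r) (e2 : pH + (gadj I y - gadj H y) = r)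
    (f : ghom x y p),
    gcomp e1 (gmor I eI f) (gnt x) = gcomp e2 (gnt y) (gmor H eH f)
}.

Lemma grnat_eq (C1 C2 : grcat) (H I : grfun C1 C2) (a b : grnat H I) :
  (forall x, a x = b x) -> a = b.
Proof.
case: a b => [a ha] [b hb] /= ab.
have {}ab : a = b by exact: functional_extensionality_dep.
by subst b; congr GrNat; exact: Prop_irrelevance.
Qed.

Section GradedCasts.
Variable C : grcat.
Implicit Types x y z : C.

Lemma gcast_linear x y p q (e : p = q) : linear (@gcast C x y p q e).
Proof. by case: _ / e. Qed.

Lemma gcast_id x y p (e : p = p) (f : ghom x y p) : gcast e f = f.
Proof. by rewrite (eq_irrelevance e erefl). Qed.

Lemma gcast_cast x y p q r (a : p = q) (b : q = r) (f : ghom x y p) :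
  gcast b (gcast a f) = gcast (etrans a b) f.
Proof. by case: _ / b; case: _ / a. Qed.

Lemma gcomp_castl x y z p q q' r (a : q = q') (e : p + q' = r)
  (g : ghom y z q) (f : ghom x y p) :
  gcomp e (gcast a g) f = gcomp (etrans (congr1 (+%R p) a) e) g f.
Proof. by subst; rewrite /=; congr gcomp; exact: eq_irrelevance. Qed.

Lemma gcomp_castr x y z p p' q r (a : p = p') (e : p' + q = r)
  (g : ghom y z q) (f : ghom x y p) :
  gcomp e g (gcast a f) = gcomp (etrans (congr1 (+%R^~ q) a) e) g f.
Proof. by subst; rewrite /=; congr gcomp; exact: eq_irrelevance. Qed.

Lemma gcast_comp x y z p q r r' (a : r = r') (e : p + q = r)
  (g : ghom y z q) (f : ghom x y p) :
  gcast a (gcomp e g f) = gcomp (etrans e a) g f.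
Proof. by subst. Qed.

Lemma gcomp1m_cast x y p r (e : p + 0 = r) (f : ghom x y p) :
  gcomp e (gid y) f = gcast (etrans (esym (addr0 p)) e) f.
Proof.
have ep : p = r by rewrite -e addr0.
by move: e; case: _ / ep => e; rewrite gcomp1m gcast_id.
Qed.

Lemma gcompm1_cast x y p r (e : 0 + p = r) (f : ghom x y p) :
  gcomp e f (gid x) = gcast (etrans (esym (add0r p)) e) f.
Proof.
have ep : p = r by rewrite -e add0r.
by move: e; case: _ / ep => e; rewrite gcompm1 gcast_id.
Qed.

Lemma gcomp_irr x y z p q r (e e' : p + q = r) (g : ghom y z q)
  (f : ghom x y p) : gcomp e g f = gcomp e' g f.
Proof. by rewrite (eq_irrelevance e e'). Qed.

Lemma gcast_irr x y p q (e e' : p = q) (f : ghom x y p) :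
  gcast e f = gcast e' f.
Proof. by rewrite (eq_irrelevance e e'). Qed.

End GradedCasts.

Lemma gmor_cast C1 C2 (H : grfun C1 C2) x y p p' q (a : p = p')
  (e : p' + gadj H y - gadj H x = q) (f : ghom x y p) :
  gmor H e (gcast a f)
  = gmor H (etrans (congr1 (fun t => t + gadj H y - gadj H x) a) e) f.
Proof. by subst; rewrite /=; congr gmor; exact: eq_irrelevance. Qed.

Lemma gcast_mor C1 C2 (H : grfun C1 C2) x y p q q' (a : q = q')
  (e : p + gadj H y - gadj H x = q) (f : ghom x y p) :
  gcast a (gmor H e f) = gmor H (etrans e a) f.
Proof. by subst. Qed.

Lemma gmor_irr C1 C2 (H : grfun C1 C2) x y p q
  (e e' : p + gadj H y - gadj H x = q) (f : ghom x y p) :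
  gmor H e f = gmor H e' f.
Proof. by rewrite (eq_irrelevance e e'). Qed.

Lemma gmor1_cast C1 C2 (H : grfun C1 C2) x q
  (e : 0 + gadj H x - gadj H x = q) :
  gmor H e (gid x) = gcast (etrans (esym (addrK _ _)) e) (gid (H x)).
Proof.
have e0 : 0 = q by rewrite -e addrK.
by move: e; case: _ / e0 => e; rewrite gmor1 gcast_id.
Qed.

Lemma gmor2_irr C1 C2 C3 (I : grfun C2 C3) (H : grfun C1 C2) x y p q q' r
  (a : p + gadj H y - gadj H x = q) (a' : p + gadj H y - gadj H x = q')
  (e : q + gadj I (H y) - gadj I (H x) = r)
  (e' : q' + gadj I (H y) - gadj I (H x) = r) (f : ghom x y p) :
  gmor I e (gmor H a f) = gmor I e' (gmor H a' f).
Proof. by subst q q'; exact: gmor_irr. Qed.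

Definition gcastE := (gcast_cast, gcomp_castl, gcomp_castr, gcast_comp,
  gmor_cast, gcast_mor, gcomp1m_cast, gcompm1_cast, gmor1_cast).

Definition grfun_id (C : grcat) : grfun C C.
Proof.
refine (@GrFun C C id (fun=> 0)
  (fun x y p q (e : p + 0 - 0 = q) f =>
     gcast (etrans (esym (etrans (subr0 _) (addr0 p))) e) f) _ _ _).
- by move=> x y p q e a f g; case: _ / (etrans _ _).
- by move=> x e; rewrite gcast_id.
- by move=> x y z p q r p' q' r' e e' ep eq er g f; rewrite !gcastE;
    exact: gcomp_irr.
Defined.

Lemma deg_comp (p a b c d q : G) :
  p + (a + c) - (b + d) = q -> p + a - b + c - d = q.
Proof. Degree.solve. Qed.

Definition grfun_comp (C1 C2 C3 : grcat) (I : grfun C2 C3) (H : grfun C1 C2) :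
  grfun C1 C3.
Proof.
refine (@GrFun C1 C3 (fun x => I (H x)) (fun x => gadj H x + gadj I (H x))
  (fun x y p q e f => gmor I (deg_comp e) (gmor H erefl f)) _ _ _).
- by move=> x y p q e a f g; rewrite !gmor_linear.
- move=> x e; rewrite gmor1_cast !gcastE gcast_id //.
- move=> x y z p q r p' q' r' e e' ep eq er g f.
  have e'' : p + gadj H y - gadj H x + (q + gadj H z - gadj H y)
    = r + gadj H z - gadj H x by Degree.solve.
  by rewrite (gmorM e e'' erefl erefl)
    (gmorM e'' e' (deg_comp ep) (deg_comp eq)).
Defined.

Definition grnat_id C1 C2 (H : grfun C1 C2) : grnat H H.
Proof.
refine (@GrNat C1 C2 H H (fun x => gcast (esym (subrr _)) (gid (H x))) _).
move=> x y p pH pI r eH eI e1 e2 f; subst; rewrite !gcastE; exact: gmor_irr.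
Defined.

Lemma deg_vcomp (a b c : G) : b - a + (c - b) = c - a.
Proof. Degree.solve. Qed.

Definition grnat_vcomp C1 C2 (H I J : grfun C1 C2) (b : grnat I J)
  (a : grnat H I) : grnat H J.
Proof.
refine (@GrNat C1 C2 H J (fun x => gcomp (deg_vcomp _ _ _) (b x) (a x)) _).
move=> x y p pH pI r eH eI e1 e2 f; subst.
have e3 : gadj I x - gadj H x + (p + gadj I y - gadj I x
    + (gadj J y - gadj I y))
  = gadj J x - gadj H x + (p + gadj J y - gadj J x) by Degree.solve.
have e4 : gadj J x - gadj I x + (p + gadj J y - gadj J x)
   = p + gadj I y - gadj I x + (gadj J y - gadj I y) by Degree.solve.
have e5 : gadj I x - gadj H x + (p + gadj I y - gadj I x)
   = p + gadj H y - gadj H x + (gadj I y - gadj H y) by Degree.solve.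
have e6 : p + gadj H y - gadj H x + (gadj I y - gadj H y)
   + (gadj J y - gadj I y)
   = gadj J x - gadj H x + (p + gadj J y - gadj J x) by Degree.solve.
rewrite -(gcompA e3 e4) (gnt_nat b (erefl _) _ _ erefl).
rewrite (gcompA _ _ e6 e5) (gnt_nat a _ _ _ erefl).
by apply: esym; exact: gcompA.
Defined.

Lemma deg_lwhisk (a b c d : G) : b - a + d - c = b + d - (a + c).
Proof. Degree.solve. Qed.

Definition grnat_lwhisk C1 C2 C3 (J : grfun C2 C3) (H I : grfun C1 C2)
  (a : grnat H I) : grnat (grfun_comp J H) (grfun_comp J I).
Proof.
refine (@GrNat C1 C3 (grfun_comp J H) (grfun_comp J I)
  (fun x => gmor J (deg_lwhisk _ _ _ _) (a x)) _).
move=> x y p pH pI r eH eI e1 e2 f; rewrite /=.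
have e3 : gadj I x - gadj H x + (p + gadj I y - gadj I x)
   = p + gadj I y - gadj H x by Degree.solve.
have e4 : p + gadj H y - gadj H x + (gadj I y - gadj H y)
   = p + gadj I y - gadj H x by Degree.solve.
have e5 : p + gadj I y - gadj H x + gadj J (I y) - gadj J (H x) = r.
  by rewrite -e1 -eI /=; Degree.solve.
by rewrite -(gmorM e3 _ _ _ e5) (gnt_nat a erefl _ _ e4)
  -(gmorM _ _ _ _ e5).
Defined.

Lemma deg_rwhisk (a b c : G) : b - a = c + b - (c + a).
Proof. Degree.solve. Qed.

Definition grnat_rwhisk C1 C2 C3 (I J : grfun C2 C3) (b : grnat I J)
  (H : grfun C1 C2) : grnat (grfun_comp I H) (grfun_comp J H).
Proof.
refine (@GrNat C1 C3 (grfun_comp I H) (grfun_comp J H)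
  (fun x => gcast (deg_rwhisk _ _ _) (b (H x))) _).
by move=> x y p pH pI r eH eI e1 e2 f; rewrite /= !gcastE; apply: gnt_nat.
Defined.

Lemma deg_assoc (a b c : G) : 0 = a + (b + c) - (a + b + c).
Proof. Degree.solve. Qed.

Lemma deg_associ (a b c : G) : 0 = a + b + c - (a + (b + c)).
Proof. Degree.solve. Qed.

Lemma deg_unitl (a : G) : 0 = a - (0 + a).
Proof. Degree.solve. Qed.

Lemma deg_unitli (a : G) : 0 = 0 + a - a.
Proof. Degree.solve. Qed.

Lemma deg_unitr (a : G) : 0 = a - (a + 0).
Proof. Degree.solve. Qed.

Lemma deg_unitri (a : G) : 0 = a + 0 - a.
Proof. Degree.solve. Qed.

Definition grnat_assoc C1 C2 C3 C4 (J : grfun C3 C4) (I : grfun C2 C3)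
  (H : grfun C1 C2) :
  grnat (grfun_comp (grfun_comp J I) H) (grfun_comp J (grfun_comp I H)).
Proof.
refine (@GrNat C1 C4 (grfun_comp (grfun_comp J I) H)
  (grfun_comp J (grfun_comp I H))
  (fun x => gcast (deg_associ _ _ _) (gid (J (I (H x))))) _).
by move=> x y p pH pI r eH eI e1 e2 f; subst; rewrite /= !gcastE /=;
  exact: gmor2_irr.
Defined.

Definition grnat_associ C1 C2 C3 C4 (J : grfun C3 C4) (I : grfun C2 C3)
  (H : grfun C1 C2) :
  grnat (grfun_comp J (grfun_comp I H)) (grfun_comp (grfun_comp J I) H).
Proof.
refine (@GrNat C1 C4 (grfun_comp J (grfun_comp I H))
  (grfun_comp (grfun_comp J I) H)
  (fun x => gcast (deg_assoc _ _ _) (gid (J (I (H x))))) _).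
by move=> x y p pH pI r eH eI e1 e2 f; subst; rewrite /= !gcastE /=;
  exact: gmor2_irr.
Defined.

Definition grnat_lunit C1 C2 (H : grfun C1 C2) :
  grnat (grfun_comp (grfun_id C2) H) H.
Proof.
refine (@GrNat C1 C2 (grfun_comp (grfun_id C2) H) H
  (fun x => gcast (deg_unitr _) (gid (H x))) _).
by move=> x y p pH pI r eH eI e1 e2 f; subst; rewrite /= !gcastE;
  exact: gmor_irr.
Defined.

Definition grnat_luniti C1 C2 (H : grfun C1 C2) :
  grnat H (grfun_comp (grfun_id C2) H).
Proof.
refine (@GrNat C1 C2 H (grfun_comp (grfun_id C2) H)
  (fun x => gcast (deg_unitri _) (gid (H x))) _).
by move=> x y p pH pI r eH eI e1 e2 f; subst; rewrite /= !gcastE;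
  exact: gmor_irr.
Defined.

Definition grnat_runit C1 C2 (H : grfun C1 C2) :
  grnat (grfun_comp H (grfun_id C1)) H.
Proof.
refine (@GrNat C1 C2 (grfun_comp H (grfun_id C1)) H
  (fun x => gcast (deg_unitl _) (gid (H x))) _).
by move=> x y p pH pI r eH eI e1 e2 f; subst; rewrite /= !gcastE;
  exact: gmor_irr.
Defined.

Definition grnat_runiti C1 C2 (H : grfun C1 C2) :
  grnat H (grfun_comp H (grfun_id C1)).
Proof.
refine (@GrNat C1 C2 H (grfun_comp H (grfun_id C1))
  (fun x => gcast (deg_unitli _) (gid (H x))) _).
by move=> x y p pH pI r eH eI e1 e2 f; subst; rewrite /= !gcastE;
  exact: gmor_irr.
Defined.

Definition hom_graded : bicat.
Proof.
refine (@Bicat grcat grfun grnat grfun_id (fun x y z => @grfun_comp x y z)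
  grnat_id grnat_vcomp
  (fun x y z h f g => @grnat_lwhisk x y z h f g)
  (fun x y z g h b f => @grnat_rwhisk x y z g h b f)
  grnat_assoc grnat_associ grnat_lunit grnat_luniti grnat_runit grnat_runiti
  _ _ _ _ _ _ _ _ _ _ _ _ _ _ _ _ _ _ _ _ _).
all: intros; apply: grnat_eq => u; rewrite /= ?gcastE.
all: try first [exact: gcomp_irr | exact: gcast_irr | exact: gcast_id
  | exact: gmor_irr | exact: gmor2_irr].
- by apply: esym; exact: gcompA.
- exact: gmorM.
- by apply: esym; exact: gnt_nat.
Defined.

(* A chi-hom-graded Serre structure: the 1-cell [grserre_fun] is the pair of S
   and l.  The dual of the graded space C(y, S x), placed so that its component
   of degree p is the dual of the component of degree l x - p of C(y, S x), is
   the codomain of kappa. *)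
Record grserre (X : character) (C : grcat) := GrSerre {
  grserre_fun :> grfun C C;
  grserre_equiv : @is_equivalence hom_graded C C grserre_fun;
  grserre_finite : forall (x y : C) p, finite_dim (ghom x y p);
  grserre_kappa : forall (x y : C) p,
    ghom x y p -> {scalar ghom y (grserre_fun x) (gadj grserre_fun x - p)};
  grserre_kappa_linear : forall (x y : C) p (a : k) (f g : ghom x y p) u,
    grserre_kappa (a *: f + g) u = a * grserre_kappa f u + grserre_kappa g u;
  grserre_kappa_bij : forall (x y : C) p, bijective (@grserre_kappa x y p);
  grserre_kappal : forall (x y z : C) p q r (e : p + q = r)
    (e' : q + (gadj grserre_fun x - r) = gadj grserre_fun x - p)
    (h : ghom y z q) (g : ghom x y p)
    (u : ghom z (grserre_fun x) (gadj grserre_fun x - r)),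
    grserre_kappa (gcomp e h g) u = X q * grserre_kappa g (gcomp e' u h);
  grserre_kappar : forall (w x y : C) p q r s (e : p + q = r)
    (es : p + gadj grserre_fun x - gadj grserre_fun w = s)
    (e' : gadj grserre_fun w - r + s = gadj grserre_fun x - q)
    (g : ghom x y q) (f : ghom w x p)
    (u : ghom y (grserre_fun w) (gadj grserre_fun w - r)),
    grserre_kappa (gcomp e g f) u
    = grserre_kappa g (gcomp e' (gmor grserre_fun es f) u)
}.

Definition admits_grserre (X : character) (C : grcat) : Prop :=
  inhabited (grserre X C).

Section EqTools.
Variable D : lincat.
Implicit Types x y z : D.

Lemma eqm_id x (e : x = x) : eqm e = idm x.
Proof. by rewrite (Prop_irrelevance e erefl). Qed.

Lemma eqm_irr x y (e e' : x = y) : eqm e = eqm e'.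
Proof. by rewrite (Prop_irrelevance e e'). Qed.

Lemma eqmM x y z (e : y = z) (e' : x = y) :
  eqm e ∘ eqm e' = eqm (etrans e' e).
Proof. by case: _ / e; rewrite /= comp1m. Qed.

Lemma fmor_eqm (E : lincat) (S : functor D E) x y (e : x = y) :
  fmor S (eqm e) = eqm (f_equal S e).
Proof. by case: _ / e; rewrite /= fmor1. Qed.

Lemma is_iso_id x : is_iso (idm x).
Proof. by exists (idm x); rewrite comp1m. Qed.

Lemma is_iso_comp x y z (g : hom y z) (f : hom x y) :
  is_iso g -> is_iso f -> is_iso (g ∘ f).
Proof.
move=> [g' [g1 g2]] [f' [f1 f2]]; exists (f' ∘ g'); split.
  by rewrite compmA -(compmA f') g1 compm1.
by rewrite compmA -(compmA g) f2 compm1.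
Qed.

Lemma is_iso_fmor (E : lincat) (S : functor D E) x y (f : hom x y) :
  is_iso f -> is_iso (fmor S f).
Proof.
by move=> [g [h1 h2]]; exists (fmor S g); rewrite -!fmorM h1 h2 !fmor1.
Qed.

(* Naturality of the comparison between equal functors. *)
Lemma eqm_feq_nat (E : lincat) (S T : functor D E) (e : S = T) x y
  (f : hom x y) :
  eqm (feq_ob e y) ∘ fmor S f = fmor T f ∘ eqm (feq_ob e x).
Proof. by subst T; rewrite /= comp1m compm1. Qed.

End EqTools.

Lemma eqnat_eq (D1 D2 : eqcat) (S T : eqfun D1 D2) (a b : eqnat S T) :
  (forall x, a x = b x) -> a = b.
Proof.
case: a b => [[a na] ha] [[b nb] hb] /= ab.
have {}ab : a = b by exact: functional_extensionality_dep.
subst b; have eqn : na = nb by exact: Prop_irrelevance.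
by subst nb; congr EqNat; exact: Prop_irrelevance.
Qed.

Definition eqfun_id (D : eqcat) : eqfun D D.
Proof.
refine (@EqFun D D (fid D) (fun p => @NatTrans _ _ (fcomp (fid D) (eact D p))
  (fcomp (eact D p) (fid D)) (fun x => idm (eact D p x)) _) _ _).
- by move=> p x; exact: is_iso_id.
- by move=> p q x; rewrite /= fmor1 compm1 !comp1m.
Unshelve. by move=> x y f; rewrite comp1m compm1.
Defined.

Definition eqfun_comp (D1 D2 D3 : eqcat) (S : eqfun D2 D3) (T : eqfun D1 D2) :
  eqfun D1 D3.
Proof.
unshelve refine (@EqFun D1 D3 (fcomp S T)
  (fun p => @NatTrans _ _ (fcomp (fcomp S T) (eact D1 p))
     (fcomp (eact D3 p) (fcomp S T))
     (fun x => eqphi S p (T x) ∘ fmor S (eqphi T p x)) _) _ _).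
- move=> x y f /=; rewrite -compmA -fmorM.
  by rewrite (nt_nat (eqphi T p) f) fmorM !compmA (nt_nat (eqphi S p) (fmor T f)).
- move=> p x; apply: is_iso_comp; first exact: eqphi_iso.
  exact: (is_iso_fmor S (eqphi_iso T p x)).
- move=> p q x /=.
  have := f_equal (fmor S) (eqphiD T p q x); rewrite !fmorM => eT.
  rewrite compmA eqphiD -(compmA _ _ (fmor S (eqphi T (p + q) x))) eT !compmA.
  congr (_ ∘ _ ∘ _); rewrite -!compmA; congr (_ ∘ _).
  exact: (nt_nat (eqphi S p) (eqphi T q x)).
Defined.

Definition eqnat_id (D1 D2 : eqcat) (S : eqfun D1 D2) : eqnat S S.
Proof.
unshelve refine (@EqNat D1 D2 S S
  (@NatTrans _ _ S S (fun x => idm (S x)) _) _).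
- by move=> x y f; rewrite comp1m compm1.
- by move=> p x; rewrite /= compm1 fmor1 comp1m.
Defined.

Definition eqnat_vcomp (D1 D2 : eqcat) (S T U : eqfun D1 D2)
  (b : eqnat T U) (a : eqnat S T) : eqnat S U.
Proof.
unshelve refine (@EqNat D1 D2 S U
  (@NatTrans _ _ S U (fun x => b x ∘ a x) _) _).
- by move=> x y f; rewrite -compmA nt_nat !compmA nt_nat.
- by move=> p x; rewrite /= compmA eqn_phi -compmA eqn_phi fmorM !compmA.
Defined.

Definition eqnat_lwhisk (D1 D2 D3 : eqcat) (U : eqfun D2 D3)
  (S T : eqfun D1 D2) (a : eqnat S T) :
  eqnat (eqfun_comp U S) (eqfun_comp U T).
Proof.
unshelve refine (@EqNat D1 D3 (eqfun_comp U S) (eqfun_comp U T)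
  (@NatTrans _ _ (fcomp U S) (fcomp U T) (fun x => fmor U (a x)) _) _).
- by move=> x y f /=; rewrite -!fmorM nt_nat.
- move=> p x; rewrite /= -compmA -fmorM eqn_phi fmorM !compmA; congr (_ ∘ _).
  exact: (nt_nat (eqphi U p) (a x)).
Defined.

Definition eqnat_rwhisk (D1 D2 D3 : eqcat) (T U : eqfun D2 D3)
  (b : eqnat T U) (S : eqfun D1 D2) :
  eqnat (eqfun_comp T S) (eqfun_comp U S).
Proof.
unshelve refine (@EqNat D1 D3 (eqfun_comp T S) (eqfun_comp U S)
  (@NatTrans _ _ (fcomp T S) (fcomp U S) (fun x => b (S x)) _) _).
- by move=> x y f; exact: (nt_nat b (fmor S f)).
- move=> p x; rewrite /= -compmA -(nt_nat b (eqphi S p x)) !compmA.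
  by congr (_ ∘ _); exact: eqn_phi.
Defined.

(* The 2-cell with identity components between 1-cells with the same underlying
   functor and structure isomorphisms. *)
Definition eqnat_ident (D1 D2 : eqcat) (S T : eqfun D1 D2)
  (o : forall x, S x = T x)
  (m : forall x y (f : hom x y),
     eqm (o y) ∘ fmor S f = fmor T f ∘ eqm (o x))
  (c : forall p x, eqphi T p x ∘ eqm (o (eact D1 p x))
     = fmor (eact D2 p) (eqm (o x)) ∘ eqphi S p x) : eqnat S T :=
  EqNat (eqn := @NatTrans _ _ S T (fun x => eqm (o x)) m) c.

Definition eqnat_assoc (D1 D2 D3 D4 : eqcat) (U : eqfun D3 D4)
  (T : eqfun D2 D3) (S : eqfun D1 D2) :
  eqnat (eqfun_comp (eqfun_comp U T) S) (eqfun_comp U (eqfun_comp T S)).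
Proof.
unshelve refine (@eqnat_ident _ _
  (eqfun_comp (eqfun_comp U T) S) (eqfun_comp U (eqfun_comp T S))
  (fun=> erefl) _ _) => [x y f|p x] /=.
- by rewrite comp1m compm1.
- by rewrite compm1 fmor1 comp1m fmorM compmA.
Defined.

Definition eqnat_associ (D1 D2 D3 D4 : eqcat) (U : eqfun D3 D4)
  (T : eqfun D2 D3) (S : eqfun D1 D2) :
  eqnat (eqfun_comp U (eqfun_comp T S)) (eqfun_comp (eqfun_comp U T) S).
Proof.
unshelve refine (@eqnat_ident _ _
  (eqfun_comp U (eqfun_comp T S)) (eqfun_comp (eqfun_comp U T) S)
  (fun=> erefl) _ _) => [x y f|p x] /=.
- by rewrite comp1m compm1.
- by rewrite compm1 fmor1 comp1m fmorM compmA.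
Defined.

Definition eqnat_lunit (D1 D2 : eqcat) (S : eqfun D1 D2) :
  eqnat (eqfun_comp (eqfun_id D2) S) S.
Proof.
unshelve refine (@eqnat_ident _ _
  (eqfun_comp (eqfun_id D2) S) S
  (fun=> erefl) _ _) => [x y f|p x] /=.
- by rewrite comp1m compm1.
- by rewrite compm1 fmor1 !comp1m.
Defined.

Definition eqnat_luniti (D1 D2 : eqcat) (S : eqfun D1 D2) :
  eqnat S (eqfun_comp (eqfun_id D2) S).
Proof.
unshelve refine (@eqnat_ident _ _
  S (eqfun_comp (eqfun_id D2) S)
  (fun=> erefl) _ _) => [x y f|p x] /=.
- by rewrite comp1m compm1.
- by rewrite compm1 fmor1 !comp1m.
Defined.

Definition eqnat_runit (D1 D2 : eqcat) (S : eqfun D1 D2) :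
  eqnat (eqfun_comp S (eqfun_id D1)) S.
Proof.
unshelve refine (@eqnat_ident _ _
  (eqfun_comp S (eqfun_id D1)) S
  (fun=> erefl) _ _) => [x y f|p x] /=.
- by rewrite comp1m compm1.
- by rewrite !fmor1 !compm1 comp1m.
Defined.

Definition eqnat_runiti (D1 D2 : eqcat) (S : eqfun D1 D2) :
  eqnat S (eqfun_comp S (eqfun_id D1)).
Proof.
unshelve refine (@eqnat_ident _ _
  S (eqfun_comp S (eqfun_id D1))
  (fun=> erefl) _ _) => [x y f|p x] /=.
- by rewrite comp1m compm1.
- by rewrite !fmor1 !compm1 comp1m.
Defined.

Definition equivariant : bicat.
Proof.
refine (@Bicat eqcat eqfun eqnat eqfun_id (fun x y z => @eqfun_comp x y z)
  eqnat_id eqnat_vcomp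
  (fun x y z h f g => @eqnat_lwhisk x y z h f g)
  (fun x y z g h b f => @eqnat_rwhisk x y z g h b f)
  eqnat_assoc eqnat_associ eqnat_lunit eqnat_luniti eqnat_runit eqnat_runiti
  _ _ _ _ _ _ _ _ _ _ _ _ _ _ _ _ _ _ _ _ _).
all: intros; apply: eqnat_eq => u;
  rewrite /= ?fmor1 ?comp1m ?compm1 ?compmA ?fmorM //.
exact: nt_nat.
Defined.

Definition act_irr (D : eqcat) (p q : G) (e : p = q) (x : D) :
  eact D p x = eact D q x := f_equal (fun t => eact D t x) e.

Definition act_comp (D : eqcat) (p q r : G) (e : p + q = r) (x : D) :
  eact D p (eact D q x) = eact D r x :=
  etrans (esym (feq_ob (actD D p q) x)) (act_irr e x).

Definition act_one (D : eqcat) (x : D) : x = eact D 0 x :=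
  esym (feq_ob (act0 D) x).

Lemma act_comp_nat (D : eqcat) (p q r : G) (e : p + q = r) (x y : D)
  (f : hom x y) :
  eqm (act_comp e y) ∘ fmor (eact D p) (fmor (eact D q) f)
  = fmor (eact D r) f ∘ eqm (act_comp e x).
Proof.
subst r; rewrite (eqm_irr _ (feq_ob (esym (actD D p q)) y)).
rewrite (eqm_irr _ (feq_ob (esym (actD D p q)) x)).
exact: (eqm_feq_nat (esym (actD D p q)) f).
Qed.

Lemma act_one_nat (D : eqcat) (x y : D) (f : hom x y) :
  eqm (act_one y) ∘ f = fmor (eact D 0) f ∘ eqm (act_one x).
Proof.
rewrite (eqm_irr _ (feq_ob (esym (act0 D)) y)).
rewrite (eqm_irr _ (feq_ob (esym (act0 D)) x)).
exact: (eqm_feq_nat (esym (act0 D)) f).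
Qed.

(* The composite of f : x -> F^p y and g : y -> F^q z is F^p g o f, followed by
   the identity F^p (F^q z) = F^(p + q) z. *)
Definition orbit_cat (D : eqcat) : grcat.
Proof.
unshelve refine (@GrCat D (fun x y p => hom x (eact D p y))
  (fun x => eqm (act_one x))
  (fun x y z p q r e g f => eqm (act_comp e z) ∘ fmor (eact D p) g ∘ f)
  _ _ _ _ _).
- by move=> x y z p q r e f a g h; rewrite fmor_linear comp_linearr comp_linearl.
- by move=> x y z p q r e g a f h; rewrite comp_linearr.
- move=> w x y z p q r pq qr pqr e1 e2 e3 e4 h g f /=.
  rewrite !fmorM !compmA; congr (_ ∘ _).
  rewrite -(compmA _ _ (eqm (act_comp e4 y))) -act_comp_nat !compmA.
  congr (_ ∘ _ ∘ _); rewrite fmor_eqm !eqmM; exact: eqm_irr.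
- move=> x y p e f; rewrite /= fmor_eqm eqmM eqm_id comp1m //.
- move=> x y p e f; rewrite /= -compmA -act_one_nat compmA eqmM eqm_id comp1m //.
Defined.

Definition act_zero (D : eqcat) (p : G) (e : 0 = p) (x : D) : x = eact D p x :=
  etrans (act_one x) (act_irr e x).

Lemma act_zero_nat (D : eqcat) (p : G) (e : 0 = p) (x y : D) (f : hom x y) :
  eqm (act_zero e y) ∘ f = fmor (eact D p) f ∘ eqm (act_zero e x).
Proof.
by subst p; rewrite (eqm_irr _ (act_one y)) (eqm_irr _ (act_one x)) act_one_nat.
Qed.

Lemma orbit_castE (D : eqcat) (x y : D) (p q : G) (e : p = q)
  (f : hom x (eact D p y)) :
  gcast (C := orbit_cat D) (x := x) (y := y) e f = eqm (act_irr e y) ∘ f.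
Proof. by subst q; rewrite eqm_id comp1m. Qed.

Section EqPhi.
Variables (D1 D2 : eqcat) (S : eqfun D1 D2).

Lemma eqphi_irr p q (e : p = q) x :
  eqphi S q x ∘ fmor S (eqm (act_irr e x))
  = eqm (act_irr e (S x)) ∘ eqphi S p x.
Proof. by subst q; rewrite !eqm_id fmor1 comp1m compm1. Qed.

Lemma eqphi_comp p q r (e : p + q = r) x :
  eqphi S r x ∘ fmor S (eqm (act_comp e x))
  = eqm (act_comp e (S x)) ∘ fmor (eact D2 p) (eqphi S q x)
    ∘ eqphi S p (eact D1 q x).
Proof.
subst r; have h := eqphiD S p q x.
set a := feq_ob (actD D2 p q) (S x) in h.
set b := feq_ob (actD D1 p q) x in h.
rewrite (eqm_irr _ (esym a)) (eqm_irr _ (esym b)).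
have h' : eqm (esym a) ∘ (eqm a ∘ eqphi S (p + q) x) ∘ fmor S (eqm (esym b))
  = eqm (esym a) ∘ (fmor (eact D2 p) (eqphi S q x) ∘ eqphi S p (eact D1 q x)
      ∘ fmor S (eqm b)) ∘ fmor S (eqm (esym b)) by rewrite h.
move: h'; rewrite !compmA eqmM eqm_id comp1m => ->.
by rewrite -!compmA -fmorM eqmM eqm_id fmor1 compm1.
Qed.

Lemma eqphi_zero p (e : 0 = p) x :
  eqphi S p x ∘ fmor S (eqm (act_zero e x)) = eqm (act_zero e (S x)).
Proof.
have e00 : 0 + 0 = 0 :> G by rewrite addr0.
set u := eqphi S 0 x ∘ fmor S (eqm (act_one x)).
suff uE : u = eqm (act_one (S x)).
  subst p; rewrite (eqm_irr _ (act_one x)) (eqm_irr _ (act_one (S x))).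
  exact: uE.
have [v [_ v2]] := eqphi_iso S 0 x.
have h : eqphi S 0 x
  = eqm (act_comp e00 (S x)) ∘ fmor (eact D2 0) u ∘ eqphi S 0 x.
  rewrite /u fmorM -!compmA -(nt_nat (eqphi S 0) (eqm (act_one x))) /= !compmA.
  rewrite -eqphi_comp -compmA -fmorM fmor_eqm eqmM eqm_id fmor1 compm1 //.
have {h} h : eqm (act_comp e00 (S x)) ∘ fmor (eact D2 0) u = idm _.
  by rewrite -v2 [in RHS]h -!compmA v2 compm1.
have w : eqm (act_comp e00 (S x)) ∘ eqm (act_one (eact D2 0 (S x))) = idm _.
  by rewrite eqmM eqm_id.
by rewrite -(comp1m u) -w -compmA act_one_nat compmA h comp1m.
Qed.

End EqPhi.

Lemma deg_zero (p q : G) : p + 0 - 0 = q -> p = q.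
Proof. by rewrite addr0 subr0. Qed.

(* The morphism f : x -> F^p y is sent to phi^p_y o S f.  Since the degree
   adjuster is 0, the target degree p + 0 - 0 is only propositionally equal
   to p. *)
Definition orbit_grfun (D1 D2 : eqcat) (S : eqfun D1 D2) :
  grfun (orbit_cat D1) (orbit_cat D2).
Proof.
refine (@GrFun (orbit_cat D1) (orbit_cat D2) S (fun=> 0)
  (fun x y p q (e : p + 0 - 0 = q) f =>
    eqm (act_irr (deg_zero e) (S y)) ∘ (eqphi S p y ∘ fmor S f)) _ _ _).
- by move=> x y p q e a f g; rewrite fmor_linear !comp_linearr.
- move=> x e; rewrite /= eqm_id comp1m.
  rewrite (eqm_irr (act_one x) (act_zero erefl x)) eqphi_zero; exact: eqm_irr.
- move=> x y z p q r p' q' r' e e' ep eq er g f /=.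
  move: (deg_zero ep) (deg_zero eq) (deg_zero er) => dp dq dr.
  move: e'; case: _ / dp; case: _ / dq; case: _ / dr => e'.
  rewrite !eqm_id !comp1m !fmorM !compmA eqphi_comp.
  rewrite (eqm_irr (act_comp e _) (act_comp e' _)) -!compmA; congr (_ ∘ (_ ∘ _)).
  by rewrite !compmA; congr (_ ∘ _); exact: (nt_nat (eqphi S p) g).
Defined.

Lemma deg_00 : 0 = 0 - 0 :> G.
Proof. by rewrite subr0. Qed.

(* The component at x is a x, seen as homogeneous of degree 0 - 0 through the
   identity T x = F^(0 - 0) (T x). *)
Definition orbit_grnat (D1 D2 : eqcat) (S T : eqfun D1 D2) (a : eqnat S T) :
  grnat (orbit_grfun S) (orbit_grfun T).
Proof.
refine (@GrNat (orbit_cat D1) (orbit_cat D2) (orbit_grfun S) (orbit_grfun T)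
  (fun x => eqm (act_zero deg_00 (T x)) ∘ a x) _).
move=> x y p pH pI r eH eI e1 e2 f /=.
move: (deg_zero eH) (deg_zero eI) => dp dq.
move: e1 e2; case: _ / dp; case: _ / dq => e1 e2.
rewrite !eqm_id !comp1m !fmorM.
rewrite -fmorM fmor_eqm !compmA -(compmA (eqm (act_comp e1 _))) -act_zero_nat.
rewrite !compmA !eqmM (eqm_irr _ (etrans (f_equal (eact D2 p)
  (act_zero deg_00 (T y))) (act_comp e2 (T y)))) -!compmA; congr (_ ∘ _).
rewrite !compmA -(eqn_phi a p y) -!compmA; congr (_ ∘ _).
by apply: esym; exact: (nt_nat a f).
Defined.

Definition orbit_unit (D : eqcat) :
  grnat (grfun_id (orbit_cat D)) (orbit_grfun (eqfun_id D)).
Proof.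
refine (@GrNat (orbit_cat D) (orbit_cat D) (grfun_id _) (orbit_grfun (eqfun_id D))
  (fun x => eqm (act_zero deg_00 x)) _).
move=> x y p pH pI r eH eI e1 e2 f /=.
rewrite orbit_castE !fmorM !fmor_eqm fmor1 !comp1m.
rewrite !compmA -(compmA _ _ (eqm (act_zero deg_00 x))) -act_zero_nat.
by rewrite !compmA !eqmM; congr (_ ∘ _); exact: eqm_irr.
Defined.

Lemma deg_000 : 0 = 0 - (0 + 0) :> G.
Proof. by rewrite addr0 subr0. Qed.

Lemma deg_000_ : 0 = 0 + 0 - 0 :> G.
Proof. by rewrite addr0 subr0. Qed.

Definition orbit_comp (D1 D2 D3 : eqcat) (S : eqfun D2 D3) (T : eqfun D1 D2) :
  grnat (grfun_comp (orbit_grfun S) (orbit_grfun T)) (orbit_grfun (eqfun_comp S T)).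
Proof.
refine (@GrNat (orbit_cat D1) (orbit_cat D3) (grfun_comp (orbit_grfun S) (orbit_grfun T))
  (orbit_grfun (eqfun_comp S T)) (fun x => eqm (act_zero deg_000 (S (T x)))) _).
move=> x y p pH pI r eH eI e1 e2 f /=.
move: (deg_zero _) (deg_zero _) (deg_zero _).
move=> d0 d1 d2; rewrite -(compmA _ _ (eqm (act_zero deg_000 (S (T x))))).
rewrite -act_zero_nat !fmorM (fmor_eqm (eact D3 pH)) !compmA.
rewrite -(compmA _ _ (fmor S (eqm (act_irr d0 (T y))))) eqphi_irr !compmA !eqmM.
by congr (_ ∘ _ ∘ _ ∘ _); exact: eqm_irr.
Defined.

Lemma grnat_invertible (C1 C2 : grcat) (H I : grfun C1 C2) (a : grnat H I)
  (b : forall x, ghom (I x) (H x) (gadj H x - gadj I x)) :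
  (forall x e, gcomp e (b x) (a x) = gid (H x)) ->
  (forall x e, gcomp e (a x) (b x) = gid (I x)) ->
  @invertible2 hom_graded C1 C2 H I a.
Proof.
move=> ba ab.
have nb x y p pH pI r
    (eH : p + gadj I y - gadj I x = pH) (eI : p + gadj H y - gadj H x = pI)
    (e1 : gadj H x - gadj I x + pI = r) (e2 : pH + (gadj H y - gadj I y) = r)
    (f : ghom x y p) :
  gcomp e1 (gmor H eI f) (b x) = gcomp e2 (b y) (gmor I eH f).
  have d1 : pI + 0 = pI by rewrite addr0.
  have d2 : gadj I y - gadj H y + (gadj H y - gadj I y) = 0 by Degree.solve.
  have d3 : pI + (gadj I y - gadj H y) + (gadj H y - gadj I y) = pI.
    by Degree.solve.
  have d4 : gadj I x - gadj H x + pH = pI + (gadj I y - gadj H y).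
    by rewrite -eH -eI; Degree.solve.
  have d5 : gadj H x - gadj I x + (pI + (gadj I y - gadj H y)) = pH.
    by rewrite -eH -eI; Degree.solve.
  have d6 : gadj H x - gadj I x + (gadj I x - gadj H x) = 0 by Degree.solve.
  have d7 : 0 + pH = pH by rewrite add0r.
  have fE : gmor H eI f = gcomp d3 (b y) (gcomp erefl (a y) (gmor H eI f)).
    by rewrite -(gcompA d1 d2) ba gcomp1m.
  rewrite fE -(gnt_nat a eI eH d4) (gcompA _ _ e2 d5) (gcompA _ _ d7 d6).
  by rewrite ab gcompm1.
exists (GrNat nb); split; apply: grnat_eq => x /=.
  have e : gadj I x - gadj H x + (gadj H x - gadj I x) = 0 by Degree.solve.
  by rewrite -(ba x e) gcast_comp; exact: gcomp_irr.
have e : gadj H x - gadj I x + (gadj I x - gadj H x) = 0 by Degree.solve.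
by rewrite -(ab x e) gcast_comp; exact: gcomp_irr.
Qed.

Lemma act_zero_natC (D : eqcat) (p : G) (e : 0 = p) (x y z : D)
  (g : hom (eact D p y) z) (f : hom x y) :
  g ∘ fmor (eact D p) f ∘ eqm (act_zero e x) = g ∘ eqm (act_zero e y) ∘ f.
Proof. by rewrite -!compmA act_zero_nat. Qed.

Lemma eqphi_zeroC (D1 D2 : eqcat) (S : eqfun D1 D2) p (e : 0 = p) x y
  (g : hom (eact D2 p (S x)) y) :
  g ∘ eqphi S p x ∘ fmor S (eqm (act_zero e x)) = g ∘ eqm (act_zero e (S x)).
Proof. by rewrite -compmA eqphi_zero. Qed.

Definition orbit_2functor : pseudofunctor equivariant hom_graded.
Proof.
unshelve refine (@Pseudofunctor equivariant hom_graded orbit_cat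
  (fun x y f => orbit_grfun f) (fun x y f g a => orbit_grnat a) orbit_unit
  (fun x y z g f => orbit_comp g f) _ _ _ _ _ _ _ _ _).
- move=> D; apply: (@grnat_invertible (orbit_cat D) (orbit_cat D)
    (grfun_id _) (orbit_grfun (eqfun_id D)) (orbit_unit D)
    (fun x => eqm (act_zero deg_00 x))) => x e /=;
  by rewrite fmor_eqm !eqmM; exact: eqm_irr.
- move=> D1 D2 D3 S T; apply: (@grnat_invertible (orbit_cat D1) (orbit_cat D3)
    (grfun_comp (orbit_grfun S) (orbit_grfun T)) (orbit_grfun (eqfun_comp S T))
    (orbit_comp S T)
    (fun x => eqm (act_zero deg_000_ (S (T x))))) => x e /=;
  by rewrite fmor_eqm !eqmM; exact: eqm_irr.
all: intros; apply: grnat_eq => u;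
  rewrite /= ?orbit_castE ?compm1 ?eqphi_zero;
  rewrite ?fmorM ?compmA ?eqphi_zeroC ?act_zero_natC ?fmor_eqm ?eqmM;
  by [exact: eqm_irr | congr (_ ∘ _); exact: eqm_irr
     | congr (_ ∘ _ ∘ _); exact: eqm_irr].
Defined.

Lemma functor_eq (C D : lincat) (S T : functor C D) (o : forall x, S x = T x) :
  (forall x y (f : hom x y), eqm (o y) ∘ fmor S f = fmor T f ∘ eqm (o x)) ->
  S = T.
Proof.
case: S T o => [So Sm Sl S1 SM] [To Tm Tl T1 TM] /= o.
have {}oE : So = To by exact: functional_extensionality_dep.
subst To; move=> h; have mE : Sm = Tm.
  apply: functional_extensionality_dep => x.
  apply: functional_extensionality_dep => y.
  apply: functional_extensionality_dep => f.
  by have := h x y f; rewrite !eqm_id comp1m compm1.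
by subst Tm; congr Functor; exact: Prop_irrelevance.
Qed.

Lemma deg_smash_comp (p q r : G) : q - p + (r - q) = r - p.
Proof. Degree.solve. Qed.

Definition smash_lincat (C : grcat) : lincat.
Proof.
refine (@LinCat (C * G) (fun x y => ghom x.1 y.1 (y.2 - x.2))
  (fun x => gcast (esym (subrr x.2)) (gid x.1))
  (fun x y z g f => gcomp (deg_smash_comp x.2 y.2 z.2) g f) _ _ _ _ _).
- by move=> x y z f; exact: gcomp_linearl.
- by move=> x y z g; exact: gcomp_linearr.
- by move=> w x y z h g f; apply: esym; exact: gcompA.
- by move=> x y f; rewrite !gcastE gcast_id.
- by move=> x y f; rewrite !gcastE gcast_id.
Defined.

Lemma smash_eqm (C : grcat) (x : C) (p q : G)
  (e : (x, p) = (x, q) :> smash_lincat C) (d : 0 = q - p) :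
  eqm e = gcast d (gid x).
Proof.
have pq : p = q := f_equal (fun z : C * G => z.2) e.
by subst q; rewrite eqm_id /=; exact: gcast_irr.
Qed.

Lemma deg_shift (p q r : G) : q - p = q + r - (p + r).
Proof. Degree.solve. Qed.

Definition smash_shift (C : grcat) (r : G) :
  functor (smash_lincat C) (smash_lincat C).
Proof.
refine (@Functor (smash_lincat C) (smash_lincat C) (fun x => (x.1, x.2 + r))
  (fun x y f => gcast (deg_shift x.2 y.2 r) f) _ _ _).
- by move=> x y; exact: gcast_linear.
- by move=> x; rewrite /= !gcastE; exact: gcast_irr.
- by move=> x y z g f; rewrite /= !gcastE; exact: gcomp_irr.
Defined.

Lemma smash_shift0 (C : grcat) : smash_shift C 0 = fid (smash_lincat C).
Proof.
have o (x : smash_lincat C) : smash_shift C 0 x = fid _ x.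
  by case: x => x p /=; rewrite addr0.
apply: (functor_eq (o := o)) => -[x p] [y q] f.
have d (r : G) : 0 = r - (r + 0) by Degree.solve.
by rewrite (@smash_eqm C y (q + 0) q (o (y, q)) (d q))
  (@smash_eqm C x (p + 0) p (o (x, p)) (d p)) /= !gcastE;
  exact: gcast_irr.
Qed.

Lemma smash_shiftD (C : grcat) (r s : G) :
  smash_shift C (r + s) = fcomp (smash_shift C r) (smash_shift C s).
Proof.
have o (x : smash_lincat C) :
    smash_shift C (r + s) x = fcomp (smash_shift C r) (smash_shift C s) x.
  by rewrite /= -addrA (addrC s).
apply: (functor_eq (o := o)) => -[x p] [y q] f.
have d (t : G) : 0 = t + s + r - (t + (r + s)) by Degree.solve.
by rewrite (@smash_eqm C y (q + (r + s)) (q + s + r) (o (y, q)) (d q))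
  (@smash_eqm C x (p + (r + s)) (p + s + r) (o (x, p)) (d p)) /= !gcastE;
  exact: gcast_irr.
Qed.

Definition smash_act (C : grcat) (r : G) : automorphism (smash_lincat C).
Proof.
refine (@Automorphism _ (smash_shift C r) (smash_shift C (- r)) _ _).
  by rewrite -smash_shiftD addNr smash_shift0.
by rewrite -smash_shiftD addrN smash_shift0.
Defined.

Definition smash_cat (C : grcat) : eqcat :=
  @EqCat (smash_lincat C) (smash_act C) (smash_shift0 C)
    (fun r s => smash_shiftD C r s).

Lemma deg_smash_mor (p q a b : G) : q - p + b - a = q + b - (p + a).
Proof. Degree.solve. Qed.

Definition smash_fun (C1 C2 : grcat) (H : grfun C1 C2) :
  functor (smash_lincat C1) (smash_lincat C2).
Proof.
refine (@Functor (smash_lincat C1) (smash_lincat C2)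
  (fun x => (H x.1, x.2 + gadj H x.1))
  (fun x y f => gmor H (deg_smash_mor x.2 y.2 (gadj H x.1) (gadj H y.1)) f)
  _ _ _).
- by move=> x y; exact: gmor_linear.
- by move=> x; rewrite /= !gcastE; exact: gcast_irr.
- by move=> x y z g f; exact: gmorM.
Defined.

Lemma deg_strict (p a r : G) : 0 = p + a + r - (p + r + a).
Proof. Degree.solve. Qed.

(* (H, gamma)#G is strictly equivariant: its structure isomorphisms are the
   identities of (H x)^(p + gamma x + r) = (H x)^(p + r + gamma x). *)
Definition smash_strict (C1 C2 : grcat) (H : grfun C1 C2) (r : G) :
  nattrans (fcomp (smash_fun H) (smash_act C1 r))
    (fcomp (smash_act C2 r) (smash_fun H)).
Proof.
refine (@NatTrans _ _ (fcomp (smash_fun H) (smash_act C1 r))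
  (fcomp (smash_act C2 r) (smash_fun H))
  (fun x => gcast (deg_strict x.2 (gadj H x.1) r) (gid (H x.1))) _).
by move=> x y f; rewrite /= !gcastE; exact: gmor_irr.
Defined.

Definition smash_eqfun (C1 C2 : grcat) (H : grfun C1 C2) :
  eqfun (smash_cat C1) (smash_cat C2).
Proof.
refine (@EqFun (smash_cat C1) (smash_cat C2) (smash_fun H) (smash_strict H) _ _).
- move=> r x.
  have d : 0 = x.2 + r + gadj H x.1 - (x.2 + gadj H x.1 + r) by Degree.solve.
  by exists (gcast d (gid (H x.1)));
    split; rewrite /= !gcastE; exact: gcast_irr.
- move=> r s [x p].
  have d1 : 0 = p + gadj H x + s + r - (p + gadj H x + (r + s)).
    by Degree.solve.
  have d2 : 0 = p + s + r - (p + (r + s)) by Degree.solve.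
  rewrite (@smash_eqm C2 (H x) (p + gadj H x + (r + s))
    (p + gadj H x + s + r) _ d1).
  rewrite (@smash_eqm C1 x (p + (r + s)) (p + s + r) _ d2) /= !gcastE; exact: gcast_irr.
Defined.

Lemma deg_smash_nat (p a b : G) : b - a = p + b - (p + a).
Proof. Degree.solve. Qed.

(* The component at x^p is t x, transported from degree gadj I x - gadj H x to
   the equal degree (p + gadj I x) - (p + gadj H x). *)
Definition smash_eqnat (C1 C2 : grcat) (H I : grfun C1 C2) (t : grnat H I) :
  eqnat (smash_eqfun H) (smash_eqfun I).
Proof.
unshelve refine (@EqNat (smash_cat C1) (smash_cat C2) (smash_eqfun H) (smash_eqfun I)
  (@NatTrans _ _ (smash_fun H) (smash_fun I)
     (fun x => gcast (deg_smash_nat x.2 (gadj H x.1) (gadj I x.1)) (t x.1)) _)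
  _).
- move=> x y f; rewrite /= !gcastE; apply: esym; exact: gnt_nat.
- by move=> r x; rewrite /= !gcastE; exact: gcast_irr.
Defined.

Lemma deg_smash_unit (p : G) : 0 = p + 0 - p.
Proof. Degree.solve. Qed.

Definition smash_unit (C : grcat) :
  eqnat (eqfun_id (smash_cat C)) (smash_eqfun (grfun_id C)).
Proof.
unshelve refine (@EqNat (smash_cat C) (smash_cat C) (eqfun_id _)
  (smash_eqfun (grfun_id C))
  (@NatTrans _ _ (fid (smash_lincat C)) (smash_fun (grfun_id C))
     (fun x => gcast (deg_smash_unit x.2) (gid x.1)) _)
  _).
- by move=> x y f; rewrite /= !gcastE; exact: gcast_irr.
- by move=> r x; rewrite /= !gcastE; exact: gcast_irr.
Defined.

Definition smash_comp (C1 C2 C3 : grcat) (I : grfun C2 C3) (H : grfun C1 C2) :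
  eqnat (eqfun_comp (smash_eqfun I) (smash_eqfun H)) (smash_eqfun (grfun_comp I H)).
Proof.
unshelve refine (@EqNat (smash_cat C1) (smash_cat C3)
  (eqfun_comp (smash_eqfun I) (smash_eqfun H)) (smash_eqfun (grfun_comp I H))
  (@NatTrans _ _ (fcomp (smash_fun I) (smash_fun H))
     (smash_fun (grfun_comp I H))
     (fun x => gcast (deg_assoc x.2 (gadj H x.1) (gadj I (H x.1)))
        (gid (I (H x.1)))) _)
  _).
- by move=> x y f; rewrite /= !gcastE; exact: gmor2_irr.
- by move=> r x; rewrite /= !gcastE; exact: gcast_irr.
Defined.

Lemma eqnat_invertible (D1 D2 : eqcat) (S T : eqfun D1 D2) (a : eqnat S T) :
  (forall x, is_iso (a x)) -> @invertible2 equivariant D1 D2 S T a.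
Proof.
move=> h; pose b x := projT1 (cid (h x)).
have hb x : b x ∘ a x = idm _ /\ a x ∘ b x = idm _ := projT2 (cid (h x)).
have nb x y (f : hom x y) : b y ∘ fmor T f = fmor S f ∘ b x.
  rewrite -[LHS]compm1 -(hb x).2 !compmA -(compmA (b y)) -nt_nat.
  by rewrite !compmA (hb y).1 comp1m.
have eb p x :
    eqphi S p x ∘ b (eact D1 p x) = fmor (eact D2 p) (b x) ∘ eqphi T p x.
  rewrite -[LHS]comp1m -(fmor1 (eact D2 p)) -(hb x).1 fmorM !compmA.
  rewrite -(compmA _ _ (eqphi S p x)) -eqn_phi -!compmA (hb _).2 compm1 //.
exists (EqNat (eqn := NatTrans nb) eb); split; apply: eqnat_eq => x /=.
  exact: (hb x).1.
exact: (hb x).2.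
Qed.

Definition smash_2functor : pseudofunctor hom_graded equivariant.
Proof.
unshelve refine (@Pseudofunctor hom_graded equivariant smash_cat
  (fun x y f => smash_eqfun f) (fun x y f g a => smash_eqnat a) smash_unit
  (fun x y z g f => smash_comp g f) _ _ _ _ _ _ _ _ _).
- move=> C; apply: eqnat_invertible => x.
  have d : 0 = x.2 - (x.2 + 0) by Degree.solve.
  by exists (gcast d (gid x.1));
    split; rewrite /= !gcastE; exact: gcast_irr.
- move=> C1 C2 C3 I H; apply: eqnat_invertible => x.
  by exists (gcast (deg_associ x.2 (gadj H x.1) (gadj I (H x.1)))
      (gid (I (H x.1))));
    split; rewrite /= !gcastE; exact: gcast_irr.
all: intros; apply: eqnat_eq => u; rewrite /= ?gcastE;
  by first [exact: gcomp_irr | exact: gcast_irr | exact: gmor_irr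
  | exact: gmor2_irr].
Defined.

Section Serre.
Variable X : character.

Definition serre_equivariant : bicat :=
  @full_sub (max_2groupoid equivariant) (@admits_eqserre X).

Definition serre_hom_graded : bicat :=
  @full_sub (max_2groupoid hom_graded) (@admits_grserre X).

Definition orbit_preserves_serre :=
  forall D : eqcat, admits_eqserre X D -> admits_grserre X (orbit_2functor D).

Definition smash_preserves_serre :=
  forall C : grcat, admits_grserre X C -> admits_eqserre X (smash_2functor C).

Definition serre_orbit (h : orbit_preserves_serre) :
    pseudofunctor serre_equivariant serre_hom_graded :=
  @pf_full (max_2groupoid equivariant) (max_2groupoid hom_graded)
    (@admits_eqserre X) (@admits_grserre X) (pf_max orbit_2functor) h.

Definition serre_smash (h : smash_preserves_serre) :
    pseudofunctor serre_hom_graded serre_equivariant :=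
  @pf_full (max_2groupoid hom_graded) (max_2groupoid equivariant)
    (@admits_grserre X) (@admits_eqserre X) (pf_max smash_2functor) h.

End Serre.

End Equivariant.
End LinearCategories.

Arguments hom {_ _}.
Arguments idm {_ _}.
Arguments compm {_ _ _ _ _}.
Arguments fmor {_ _ _} _ {_ _}.
Arguments serre_kappa {_ _} _ {_ _}.
Arguments eqphi {_ _ _ _}.
Arguments ghom {_ _ _}.
Arguments gid {_ _ _}.
Arguments gcomp {_ _ _ _ _ _ _ _ _}.
Arguments gadj {_ _ _ _}.
Arguments gmor {_ _ _ _} _ {_ _ _ _}.

Notation "g ∘ f" := (compm g f).

Arguments equivariant : clear implicits.
Arguments hom_graded : clear implicits.
Arguments orbit_2functor : clear implicits.
Arguments smash_2functor : clear implicits.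

(* Main.v *)
From HB Require Import structures.
From mathcomp Require Import all_boot all_algebra.
From mathcomp Require Import boolp.
Require Import Defs.

Set Implicit Arguments.
Unset Strict Implicit.
Unset Printing Implicit Defensive.

Import GRing.Theory.
Local Open Scope ring_scope.

(** The two biequivalences are witnessed by explicit pseudonatural
    transformations.

    On the equivariant side, [eta D] embeds D into (D/G)#G by x |-> x^0.  Its
    equivariance isomorphism (F^p x)^0 -> x^p is the identity of F^p x, read as
    a morphism of degree p from F^p x to x in D/G.  It is an equivalence because
    x^p |-> F^p x is a strictly equivariant quasi-inverse ([eta_inv]).  All the
    coherence identities reduce to the fact that two comparison morphisms
    between equal objects agree: identities of the form F^p F^q x = F^(p+q) x
    are moved to the front of a composite, merged, and compared.

    On the hom-graded side, [omega C] embeds C into (C#G)/G by x |-> x^0 with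
    degree adjuster 0.  It is bijective on morphisms of each degree, and each
    x^p is isomorphic to x^0 by a homogeneous isomorphism, of degree p; such a
    1-cell is an equivalence ([fully_faithful_equivalence]), the degrees of the
    chosen isomorphisms providing the adjuster of the inverse.

    The restriction to objects with Serre structures follows as soon as both
    functors preserve these objects: a pseudonatural equivalence has
    equivalences as 1-cells and invertible 2-cells, so it lives in the maximal
    2-groupoid, and full sub-2-groupoids are no constraint on 1- and 2-cells.

    For D/G, the pairing of f : x -> F^p y with u : y -> F^(-p) S x is
    chi(p) kappa(f)(F^p u).  The factor chi(p) is forced, up to a constant, by
    the left rule of a chi-hom-graded Serre structure, and it turns the right
    rule into the characterisation of zeta combined with s^p = chi(p) zeta.  That
    (S, s) is a 1-cell at all, meaning that s consists of isomorphisms and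
    satisfies the cocycle condition, is a uniqueness argument: composites of the
    zetas of two automorphisms have the property that characterises the zeta of
    their composite ([zeta_compat_comp], [zeta_compat_unique]).  Invertibility of
    zeta uses that, by finite-dimensionality, every linear form on a hom space is
    evaluation at a morphism ([form_representable]).

    For C#G, the pairing of f : x^p -> y^q with u is chi(q)^-1 kappa(f)(u), where
    q belongs to the target.  Then zeta of the shift by r is chi(r)^-1 times the
    identity, so that s is the strict equivariance of S#G. *)

(** * Restricting pseudonatural equivalences to sub-2-groupoids *)

Section RestrictFull.
Variables (B C : bicat) (A : B -> Prop) (A' : C -> Prop).
Variables (P : pseudofunctor B C) (Q : pseudofunctor C B).
Variable hP : forall x : B, A x -> A' (P x).
Variable hQ : forall x : C, A' x -> A (Q x).

Lemma pseudonat_equivalent_full :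
  pseudonat_equivalent (pf_id B) (pf_compose Q P) ->
  pseudonat_equivalent (pf_id (full_sub A))
    (pf_compose (pf_full hQ) (pf_full hP)).
Proof.
move=> [s hs]; unshelve eexists.
- refine (@Pseudonat (full_sub A) (full_sub A) (pf_id _)
    (pf_compose (pf_full hQ) (pf_full hP)) (fun x => s (sval x))
    (fun x y f => pn1 s f) (fun x y f => pn1_inv s f)
    (fun x y f g a => pn_nat s a) (fun x => pn_unit s (sval x))
    (fun x y z g f => pn_comp s g f)).
- by move=> x; exact: (hs (sval x)).
Qed.

End RestrictFull.

Section RestrictMax.
Variable B : bicat.

Lemma max_invertible2 (x y : max_2groupoid B) (f g : cell1 x y)
  (a : cell2 f g) : invertible2 a.
Proof.
case: a => a [b [b1 b2]].
by exists (exist _ b (ex_intro _ a (conj b2 b1))); split; apply: sval_eq.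
Qed.

Lemma is_equivalence_inverse (x y : B) (f : cell1 x y) :
  is_equivalence f -> exists g : cell1 y x, is_equivalence g /\
    (exists a : cell2 (id1 x) (g ⊚ f), invertible2 a) /\
    (exists b : cell2 (f ⊚ g) (id1 y), invertible2 b).
Proof.
move=> [g [[a ia] [b ib]]]; exists g; split; last by split; [exists a | exists b].
have [a' ia'] := invertible2_sym ia; have [b' ib'] := invertible2_sym ib.
by exists f; split; [exists b' | exists a'].
Qed.

(** The quasi-inverse and the invertible 2-cells that exhibit an equivalence all
    survive in the maximal sub-2-groupoid. *)
Lemma max_is_equivalence (x y : max_2groupoid B)
  (f : cell1 x y) : is_equivalence f.
Proof.
case: f => f hf; have [g [hg [[a ia] [b ib]]]] := is_equivalence_inverse hf.
exists (exist _ g hg); split.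
  by exists (exist _ a ia); exact: max_invertible2.
by exists (exist _ b ib); exact: max_invertible2.
Qed.

(** The 1-cells and 2-cells of a pseudonatural equivalence are already
    equivalences and invertible 2-cells, hence cells of the 2-groupoid. *)
Lemma pseudonat_equivalent_max (C : bicat) (P : pseudofunctor B C)
  (Q : pseudofunctor C B) :
  pseudonat_equivalent (pf_id B) (pf_compose Q P) ->
  pseudonat_equivalent (pf_id (max_2groupoid B))
    (pf_compose (pf_max Q) (pf_max P)).
Proof.
move=> [s hs]; unshelve eexists.
- refine (@Pseudonat (max_2groupoid B) (max_2groupoid B) (pf_id _)
    (pf_compose (pf_max Q) (pf_max P))
    (fun x => exist _ (s x) (hs x))
    (fun x y f => exist _ (pn1 s (sval f)) (pn1_inv s (sval f))) _ _ _ _).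
  + by move=> x y f; exact: max_invertible2.
  + by move=> x y f g a; apply: sval_eq; exact: (pn_nat s (sval a)).
  + by move=> x; apply: sval_eq; exact: (pn_unit s).
  + by move=> x y z g f; apply: sval_eq; exact: (pn_comp s).
- by move=> x; exact: max_is_equivalence.
Qed.

End RestrictMax.

(** * Homogeneous morphisms of unspecified degree *)

Reserved Notation "g ⋅ f" (at level 40, left associativity).

Section Homogeneous.
Variables (k : fieldType) (G : zmodType).

(** Bundling a morphism with its degree makes composition strictly associative
    and unital, with no side equation between degrees.  Identities between
    homogeneous morphisms are proved here and brought back by [hg_inj]. *)
Definition homogeneous (C : grcat k G) (x y : C) := {p : G & ghom x y p}.

Definition hg (C : grcat k G) (x y : C) p (f : ghom x y p) : homogeneous x y :=
  existT _ p f.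

Definition hcomp (C : grcat k G) (x y z : C) (g : homogeneous y z)
    (f : homogeneous x y) : homogeneous x z :=
  hg (gcomp erefl (projT2 g) (projT2 f)).

Definition hmor (C1 C2 : grcat k G) (H : grfun C1 C2) (x y : C1)
    (f : homogeneous x y) : homogeneous (H x) (H y) :=
  hg (gmor H erefl (projT2 f)).

Local Notation "g ⋅ f" := (hcomp g f).

Section Cat.
Variable C : grcat k G.
Implicit Types w x y z : C.

Lemma hg_cast x y p q (e : p = q) (f : ghom x y p) : hg (gcast e f) = hg f.
Proof. by subst. Qed.

Lemma hg_inj x y p : injective (@hg C x y p).
Proof.
have key (u v : homogeneous x y) : u = v ->
    exists e : projT1 u = projT1 v, gcast e (projT2 u) = projT2 v.
  by move=> ->; exists erefl.
by move=> f g /key [e /=]; rewrite gcast_id.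
Qed.

Lemma hg_comp x y z p q r (e : p + q = r) (g : ghom y z q) (f : ghom x y p) :
  hg (gcomp e g f) = hg g ⋅ hg f.
Proof. by subst. Qed.

Lemma hcompA w x y z (h : homogeneous y z) (g : homogeneous x y)
  (f : homogeneous w x) : h ⋅ (g ⋅ f) = h ⋅ g ⋅ f.
Proof.
case: h g f => r h [q g] [p f].
rewrite /hcomp /= (gcompA erefl erefl (esym (addrA _ _ _)) erefl).
by rewrite !hg_comp.
Qed.

Lemma hcomp1m x y (f : homogeneous x y) : hg (gid y) ⋅ f = f.
Proof.
by case: f => p f; rewrite -(hg_comp (addr0 p)) gcomp1m.
Qed.

Lemma hcompm1 x y (f : homogeneous x y) : f ⋅ hg (gid x) = f.
Proof.
by case: f => p f; rewrite -(hg_comp (add0r p)) gcompm1.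
Qed.

End Cat.

Section Fun.
Variables (C1 C2 : grcat k G) (H : grfun C1 C2).

Lemma hg_mor x y p q (e : p + gadj H y - gadj H x = q) (f : ghom x y p) :
  hg (gmor H e f) = hmor H (hg f).
Proof. by subst. Qed.

Lemma hmor1 x : hmor H (hg (gid x)) = hg (gid (H x)).
Proof. by rewrite /hmor gmor1_cast hg_cast. Qed.

Lemma hmorM x y z (g : homogeneous y z) (f : homogeneous x y) :
  hmor H (g ⋅ f) = hmor H g ⋅ hmor H f.
Proof.
case: f g => p f [q g].
have e : p + gadj H y - gadj H x + (q + gadj H z - gadj H y)
  = p + q + gadj H z - gadj H x by Degree.solve.
by rewrite /hmor (gmorM erefl e erefl erefl erefl g f) hg_comp.
Qed.

End Fun.

Lemma grnatP (C1 C2 : grcat k G) (H I : grfun C1 C2)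
  (a : forall x, ghom (H x) (I x) (gadj I x - gadj H x)) :
  (forall x y p (f : ghom x y p),
     hmor I (hg f) ⋅ hg (a x) = hg (a y) ⋅ hmor H (hg f)) ->
  forall x y p pH pI r
    (eH : p + gadj H y - gadj H x = pH) (eI : p + gadj I y - gadj I x = pI)
    (e1 : gadj I x - gadj H x + pI = r) (e2 : pH + (gadj I y - gadj H y) = r)
    (f : ghom x y p),
    gcomp e1 (gmor I eI f) (a x) = gcomp e2 (a y) (gmor H eH f).
Proof. by move=> h *; apply: hg_inj; rewrite !hg_comp !hg_mor h. Qed.

Lemma hmor_id (C : grcat k G) (x y : C) (f : homogeneous x y) :
  hmor (grfun_id C) f = f.
Proof. by case: f => p f; rewrite /hmor /= hg_cast. Qed.

Lemma hmor_comp (C1 C2 C3 : grcat k G) (J : grfun C2 C3) (H : grfun C1 C2)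
  (x y : C1) (f : homogeneous x y) :
  hmor (grfun_comp J H) f = hmor J (hmor H f).
Proof. by case: f => p f; rewrite /hmor /= !hg_mor. Qed.

End Homogeneous.

Notation "g ⋅ f" := (hcomp g f).

(** * Fully faithful and essentially surjective graded functors *)

Section GradedEquivalence.
Variables (k : fieldType) (G : zmodType).

Variables (C1 C2 : grcat k G) (H : grfun C1 C2).
Hypothesis ff : forall x y p q (e : p + gadj H y - gadj H x = q),
  bijective (gmor H e).
Hypothesis es : forall y : C2, exists x d (b : ghom (H x) y d)
  (b' : ghom y (H x) (- d)),
  hg b' ⋅ hg b = hg (gid (H x)) /\ hg b ⋅ hg b' = hg (gid y).

(** A preimage of y up to a homogeneous isomorphism of arbitrary degree. *)
Record preimage (y : C2) := Preimage {
  pre : C1;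
  pdeg : G;
  pto : ghom (H pre) y pdeg;
  pfrom : ghom y (H pre) (- pdeg);
  ptoK : hg pfrom ⋅ hg pto = hg (gid (H pre));
  pfromK : hg pto ⋅ hg pfrom = hg (gid y)
}.

Lemma preimageP y : inhabited (preimage y).
Proof.
have [x [d [b [b' [b1 b2]]]]] := es y.
exact: (inhabits (Preimage b1 b2)).
Qed.

Let P (y : C2) : preimage y := projT1 (cid (let: inhabits p := preimageP y in
  ex_intro (fun=> True) p I)).

Let gmor_inj x y p q (e : p + gadj H y - gadj H x = q) : injective (gmor H e).
Proof. exact: bij_inj (ff e). Qed.

Let hmor_inj x y : injective (@hmor k G C1 C2 H x y).
Proof.
move=> [p f] [q g] h.
have pq : p = q.
  by move: (f_equal (@projT1 _ _) h) => /= /addIr /addIr.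
by subst q; have /= -> := gmor_inj (hg_inj h).
Qed.

Let preim x y p q (e : p + gadj H y - gadj H x = q) (g : ghom (H x) (H y) q) :
  {f : ghom x y p | gmor H e f = g}.
Proof. by apply: cid; case: (ff e) => h _ hK; exists (h g). Qed.

(* The image under H of a morphism of degree q between chosen preimages has
   degree q + gadj H z - gadj H y, while conjugating a morphism of degree p by
   the chosen isomorphisms gives degree p + pdeg y - pdeg z. *)
Let adj (y : C2) := - pdeg (P y) - gadj H (pre (P y)).

Let deg_adj (p a b c d q : G) :
  p + (- b - d) - (- a - c) = q -> a + p - b = q + d - c.
Proof. Degree.solve. Qed.

Let conjugate y z p q (e : p + adj z - adj y = q) (f : ghom y z p) :=
  gcomp (deg_adj e) (pfrom (P z)) (gcomp erefl f (pto (P y))).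

Let inverse_mor y z p q (e : p + adj z - adj y = q) (f : ghom y z p) :=
  sval (preim erefl (conjugate e f)).

Let hg_inverse_mor y z p q (e : p + adj z - adj y = q) (f : ghom y z p) :
  hmor H (hg (inverse_mor e f)) = hg (pfrom (P z)) ⋅ hg f ⋅ hg (pto (P y)).
Proof.
rewrite -(hg_mor (H := H) erefl) (svalP (preim erefl (conjugate e f))).
by rewrite !hg_comp hcompA.
Qed.

Let inverse : grfun C2 C1.
Proof.
refine (@GrFun k G C2 C1 (fun y => pre (P y)) adj inverse_mor _ _ _).
- move=> x y p q e a f g; apply: (gmor_inj (e := erefl)).
  rewrite gmor_linear !(svalP (preim erefl _)).
  by rewrite /conjugate gcomp_linearl gcomp_linearr.
- move=> x e; apply: (gmor_inj (e := erefl)); apply: hg_inj.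
  by rewrite !hg_mor hg_inverse_mor hmor1 hcompm1 ptoK.
- move=> x y z p q r p' q' r' e e' ep eq er g f.
  apply: (gmor_inj (e := erefl)); apply: hg_inj.
  rewrite !hg_mor !hg_comp hmorM !hg_inverse_mor hg_comp !hcompA.
  congr (_ ⋅ _ ⋅ _).
  by rewrite -(hcompA _ (hg (pto (P y)))) pfromK hcompm1.
Defined.

Let hmor_inverse y z (f : homogeneous y z) :
  hmor H (hmor inverse f) = hg (pfrom (P z)) ⋅ f ⋅ hg (pto (P y)).
Proof. by case: f => p f; exact: hg_inverse_mor. Qed.

Let deg_unit (a b c : G) : c + (- b - a) - 0 + a - c = - b.
Proof. Degree.solve. Qed.

Let unit_cell x := preim (deg_unit (gadj H (pre (P (H x)))) (pdeg (P (H x)))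
  (gadj H x)) (pfrom (P (H x))).

Let hg_unit_cell x : hmor H (hg (sval (unit_cell x))) = hg (pfrom (P (H x))).
Proof. by rewrite -(hg_mor (deg_unit _ _ _)) (svalP (unit_cell x)). Qed.

Let inverse_unit : grnat (grfun_id C1) (grfun_comp inverse H).
Proof.
refine (@GrNat k G C1 C1 (grfun_id C1) (grfun_comp inverse H)
  (fun x => sval (unit_cell x)) _).
apply: grnatP => x y p f.
apply: hmor_inj; rewrite !hmorM hmor_id hmor_comp hmor_inverse.
by rewrite !hg_unit_cell -!hcompA pfromK hcompm1.
Defined.

Let deg_counit (b c : G) : b = 0 - (- b - c + c).
Proof. Degree.solve. Qed.

Let inverse_counit : grnat (grfun_comp H inverse) (grfun_id C2).
Proof.
refine (@GrNat k G C2 C2 (grfun_comp H inverse) (grfun_id C2)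
  (fun y => gcast (deg_counit (pdeg (P y)) (gadj H (pre (P y)))) (pto (P y))) _).
apply: grnatP => x y p f.
by rewrite !hg_cast hmor_id hmor_comp hmor_inverse !hcompA pfromK hcomp1m.
Defined.

Let deg_unitV (a b c : G) : b + a - c = 0 - (c + (- b - a)).
Proof. Degree.solve. Qed.

Let deg_unitV' (a b c : G) : b + a - c + c - a = b.
Proof. Degree.solve. Qed.

Let deg_counitV (b c : G) : - b = - b - c + c - 0.
Proof. Degree.solve. Qed.

(** The usual criterion for equivalences, with essential surjectivity up to
    isomorphisms of any degree: the degree adjuster of the quasi-inverse
    absorbs their degrees, so that the 2-cells have the degrees they must. *)
Lemma fully_faithful_equivalence : @is_equivalence (hom_graded k G) C1 C2 H.
Proof.
exists inverse; split.
  have v x := preim (deg_unitV' (gadj H (pre (P (H x)))) (pdeg (P (H x)))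
    (gadj H x)) (pto (P (H x))).
  exists inverse_unit.
  by apply: (@grnat_invertible k G C1 C1 (grfun_id C1)
      (grfun_comp inverse H) inverse_unit
      (fun x => gcast (deg_unitV _ _ _) (sval (v x)))) => x e;
    apply: hg_inj; rewrite hg_comp hg_cast; apply: hmor_inj;
    rewrite hmorM hg_unit_cell hmor1 -(hg_mor (deg_unitV' _ _ _));
    rewrite (svalP (v x)) ?ptoK ?pfromK.
exists inverse_counit.
by apply: (@grnat_invertible k G C2 C2 (grfun_comp H inverse)
    (grfun_id C2) inverse_counit
    (fun y => gcast (deg_counitV (pdeg (P y)) (gadj H (pre (P y))))
       (pfrom (P y)))) => x e;
  apply: hg_inj; rewrite hg_comp !hg_cast ?ptoK ?pfromK.
Qed.

End GradedEquivalence.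

(** * Comparison morphisms between translates *)

Section Comparison.
Variables (k : fieldType) (G : zmodType).

Lemma smash_deg (C : grcat k G) (x : C) p q
  (e : (x, p) = (x, q) :> smash_lincat C) : 0 = q - p.
Proof. by rewrite -[p]/((x, p).2) e subrr. Qed.

(** A form of [smash_eqm] that rewrites without being told the degree proof. *)
Lemma smash_eqmE (C : grcat k G) (x : C) p q
  (e : (x, p) = (x, q) :> smash_lincat C) :
  eqm e = gcast (smash_deg e) (gid x).
Proof. exact: smash_eqm. Qed.

Lemma act_irr_nat (D : eqcat k G) (p q : G) (e : p = q) (x y : D)
  (f : hom x y) :
  fmor (eact D q) f ∘ eqm (act_irr e x) = eqm (act_irr e y) ∘ fmor (eact D p) f.
Proof. by subst q; rewrite !eqm_id comp1m compm1. Qed.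

Lemma act_compV_nat (D : eqcat k G) (p q r : G) (e : p + q = r) (x y : D)
  (f : hom x y) :
  fmor (eact D p) (fmor (eact D q) f) ∘ eqm (esym (act_comp e x))
  = eqm (esym (act_comp e y)) ∘ fmor (eact D r) f.
Proof.
rewrite -[LHS]comp1m -(eqm_id (etrans (act_comp e y) (esym (act_comp e y)))).
rewrite -eqmM -!compmA; congr (_ ∘ _).
by rewrite compmA act_comp_nat -compmA eqmM eqm_id compm1.
Qed.

(* The same rules under a further composite, for left-associated chains. *)
Section Chains.
Variables (D : eqcat k G) (x y z : D) (p q r : G) (f : hom x y).

Lemma act_irr_natC (e : p = q) (g : hom (eact D q y) z) :
  g ∘ fmor (eact D q) f ∘ eqm (act_irr e x)
  = g ∘ eqm (act_irr e y) ∘ fmor (eact D p) f.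
Proof. by rewrite -!compmA act_irr_nat. Qed.

Lemma act_comp_natC (e : p + q = r) (g : hom (eact D r y) z) :
  g ∘ fmor (eact D r) f ∘ eqm (act_comp e x)
  = g ∘ eqm (act_comp e y) ∘ fmor (eact D p) (fmor (eact D q) f).
Proof. by rewrite -!compmA act_comp_nat. Qed.

Lemma act_compV_natC (e : p + q = r) (g : hom (eact D p (eact D q y)) z) :
  g ∘ fmor (eact D p) (fmor (eact D q) f) ∘ eqm (esym (act_comp e x))
  = g ∘ eqm (esym (act_comp e y)) ∘ fmor (eact D r) f.
Proof. by rewrite -!compmA act_compV_nat. Qed.

End Chains.

Definition act_nat := (act_irr_nat, act_compV_nat).

Definition act_natC := (act_irr_natC, act_zero_natC, act_comp_natC,
  act_compV_natC).

Lemma eqphi_irrC (D1 D2 : eqcat k G) (S : eqfun D1 D2) p q (e : p = q) x y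
  (g : hom (eact D2 q (S x)) y) :
  g ∘ eqphi S q x ∘ fmor S (eqm (act_irr e x))
  = g ∘ eqm (act_irr e (S x)) ∘ eqphi S p x.
Proof. by rewrite -!compmA eqphi_irr. Qed.

Definition eqphiE := (eqphi_zero, eqphi_zeroC, eqphi_irr, eqphi_irrC).

End Comparison.

(* The comparison morphisms are moved to the left of a composite and merged into
   one; the rules for equivariance isomorphisms come before the functors
   distribute over composites, since afterwards they no longer match. *)
Ltac act_normalize :=
  rewrite /= ?orbit_castE ?compm1 ?comp1m ?eqphiE ?fmorM ?compmA ?eqphiE ?compmA;
  repeat (progress (rewrite ?act_nat ?act_natC ?fmor_eqm ?compmA ?eqmM));
  rewrite ?(fmor_eqm, eqmM).

Ltac act_solve := act_normalize;
  by [exact: eqm_irr | congr (_ ∘ _); exact: eqm_irr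
     | congr (_ ∘ _ ∘ _); exact: eqm_irr
     | congr (_ ∘ _ ∘ _ ∘ _); exact: eqm_irr].

(** * The embedding of D into (D/G)#G *)

Section EquivariantUnit.
Variables (k : fieldType) (G : zmodType).

Section Eta.
Variable D : eqcat k G.

Lemma deg_eta_phi (p : G) : p = 0 + p - 0.
Proof. Degree.solve. Qed.

(** Morphisms from x^0 to y^0 have degree 0 - 0, so D(x, y) is carried to
    D(x, F^(0-0) y). *)
Definition eta_functor : functor D (smash_lincat (orbit_cat D)).
Proof.
refine (@Functor k D (smash_lincat (orbit_cat D)) (fun x => (x, 0))
  (fun x y f => eqm (act_zero (@deg_00 G) y) ∘ f) _ _ _).
- by move=> x y; exact: comp_linearr.
- by move=> x; act_solve.
- by move=> x y z g f; act_solve.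
Defined.

(** Morphisms of degree p from F^p x to x in D/G are the endomorphisms of F^p x
    in D; the component at x is the identity among them. *)
Definition eta_phi (p : G) : nattrans (fcomp eta_functor (eact D p))
  (fcomp (eact (smash_cat (orbit_cat D)) p) eta_functor).
Proof.
refine (@NatTrans k _ _ (fcomp eta_functor (eact D p))
     (fcomp (eact (smash_cat (orbit_cat D)) p) eta_functor)
     (fun x => eqm (act_irr (deg_eta_phi p) x)) _).
by move=> x y f; act_solve.
Defined.

Definition eta : eqfun D (smash_cat (orbit_cat D)).
Proof.
refine (@EqFun k G D (smash_cat (orbit_cat D)) eta_functor eta_phi _ _).
- have d (p : G) : 0 - (0 + p) + p = 0 by Degree.solve.
  move=> p x; exists (eqm (etrans (act_one x) (esym (act_comp (d p) x)))).
  by split; act_solve.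
- by move=> p q x; rewrite smash_eqmE; act_solve.
Defined.

Lemma deg_eta_inv (p q : G) : p + (q - p) = q.
Proof. Degree.solve. Qed.

(** On morphisms of degree q - p from x to y, x^p |-> F^p x applies F^p to reach
    F^p F^(q-p) y = F^q y. *)
Definition eta_inv_functor : functor (smash_lincat (orbit_cat D)) D.
Proof.
refine (@Functor k (smash_lincat (orbit_cat D)) D (fun u => eact D u.2 u.1)
  (fun u v f => eqm (act_comp (deg_eta_inv u.2 v.2) v.1) ∘ fmor (eact D u.2) f)
  _ _ _).
- by move=> u v a f g; rewrite fmor_linear comp_linearr.
- by move=> u; act_normalize; rewrite eqm_id.
- by move=> u v w g f; act_solve.
Defined.

Definition eta_inv_phi (r : G) : nattrans
  (fcomp eta_inv_functor (eact (smash_cat (orbit_cat D)) r))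
  (fcomp (eact D r) eta_inv_functor).
Proof.
refine (@NatTrans k _ _
  (fcomp eta_inv_functor (eact (smash_cat (orbit_cat D)) r))
  (fcomp (eact D r) eta_inv_functor)
  (fun u => eqm (esym (act_comp (addrC r u.2) u.1))) _).
by move=> u v f; act_solve.
Defined.

Definition eta_inv : eqfun (smash_cat (orbit_cat D)) D.
Proof.
refine (@EqFun k G (smash_cat (orbit_cat D)) D eta_inv_functor eta_inv_phi _ _).
- move=> r u; exists (eqm (act_comp (addrC r u.2) u.1)).
  by split; act_normalize; rewrite eqm_id.
- by move=> r s [x p]; rewrite smash_eqmE; act_solve.
Defined.

Definition eta_unit : eqnat (eqfun_id D) (eqfun_comp eta_inv eta).
Proof.
unshelve refine (@EqNat k G D D (eqfun_id D) (eqfun_comp eta_inv eta)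
  (@NatTrans k _ _ (fid D) (fcomp eta_inv_functor eta_functor)
    (fun x => eqm (act_zero erefl x)) _) _).
- by move=> x y f; act_solve.
- by move=> r x; act_solve.
Defined.

Lemma deg_eta_counit (p : G) : p = p - 0.
Proof. by rewrite subr0. Qed.

Definition eta_counit :
  eqnat (eqfun_comp eta eta_inv) (eqfun_id (smash_cat (orbit_cat D))).
Proof.
unshelve refine (@EqNat k G _ _ (eqfun_comp eta eta_inv) (eqfun_id _)
  (@NatTrans k _ _ (fcomp eta_functor eta_inv_functor) (fid _)
    (fun u => eqm (act_irr (deg_eta_counit u.2) u.1)) _) _).
- by move=> u v f; act_solve.
- by move=> r u; act_solve.
Defined.

Lemma eta_is_equivalence :
  @is_equivalence (equivariant k G) D (smash_cat (orbit_cat D)) eta.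
Proof.
exists eta_inv; split.
  exists eta_unit; apply: eqnat_invertible => x.
  by exists (eqm (esym (act_zero erefl x))); split; act_normalize; rewrite eqm_id.
exists eta_counit; apply: eqnat_invertible => u.
have d (p : G) : 0 - p + p = 0 by Degree.solve.
exists (eqm (etrans (act_one u.1) (esym (act_comp (d u.2) u.1)))).
by split; act_solve.
Qed.

End Eta.

Lemma deg_eta_nat : 0 = 0 - (0 + 0) :> G.
Proof. Degree.solve. Qed.

Definition eta_nat (D1 D2 : eqcat k G) (S : eqfun D1 D2) :
  eqnat (eqfun_comp (smash_eqfun (orbit_grfun S)) (eta D1))
    (eqfun_comp (eta D2) S).
Proof.
unshelve refine (@EqNat k G _ _
  (eqfun_comp (smash_eqfun (orbit_grfun S)) (eta D1))
  (eqfun_comp (eta D2) S)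
  (@NatTrans k _ _ (fcomp (smash_fun (orbit_grfun S)) (eta_functor D1))
    (fcomp (eta_functor D2) S)
    (fun x => eqm (act_zero deg_eta_nat (S x))) _) _).
- by move=> x y f; act_solve.
- by move=> r x; act_solve.
Defined.

Lemma eta_nat_invertible (D1 D2 : eqcat k G) (S : eqfun D1 D2) :
  @invertible2 (equivariant k G) _ _ _ _ (eta_nat S).
Proof.
apply: eqnat_invertible => x; have d : 0 = 0 + 0 - 0 :> G by Degree.solve.
by exists (eqm (act_zero d (S x))); split; act_solve.
Qed.

Lemma eta_pseudonat : pseudonat_equivalent (pf_id (equivariant k G))
  (pf_compose (smash_2functor k G) (orbit_2functor k G)).
Proof.
unshelve eexists.
- refine (@Pseudonat (equivariant k G) (equivariant k G) (pf_id _)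
    (pf_compose (smash_2functor k G) (orbit_2functor k G))
    (fun D => eta D) (fun D1 D2 S => eta_nat S)
    (fun D1 D2 S => eta_nat_invertible S) _ _ _).
  + by move=> D1 D2 S T a; apply: eqnat_eq => x; act_solve.
  + by move=> D; apply: eqnat_eq => x; act_solve.
  + by move=> D1 D2 D3 T S; apply: eqnat_eq => x; act_solve.
- exact: eta_is_equivalence.
Qed.

End EquivariantUnit.

(** * The embedding of C into (C#G)/G *)

(* Morphisms of C#G and (C#G)/G are those of C in a given degree; after
   unfolding, only the proofs that degrees agree can differ. *)
Ltac cast_normalize :=
  rewrite /= ?orbit_castE ?smash_eqmE /= ?gcastE.

Ltac cast_solve := cast_normalize;
  by [exact: gcast_irr | exact: gcomp_irr | exact: gmor_irr | exact: gmor2_irr].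

Section Omega.
Variables (k : fieldType) (G : zmodType).

Lemma deg_omega (p q : G) : p + 0 - 0 = q -> p = 0 + q - 0.
Proof. Degree.solve. Qed.

(** The morphisms of degree q from x^0 to y^0 are those of degree 0 + q - 0 from
    x to y. *)
Definition omega (C : grcat k G) : grfun C (orbit_cat (smash_cat C)).
Proof.
refine (@GrFun k G C (orbit_cat (smash_cat C)) (fun x => (x, 0)) (fun=> 0)
  (fun x y p q e f => gcast (deg_omega e) f) _ _ _).
- by move=> x y p q e; exact: gcast_linear.
- by move=> x e; cast_solve.
- by move=> x y z p q r p' q' r' e e' ep eq er g f; cast_solve.
Defined.

Lemma omega_is_equivalence (C : grcat k G) :
  @is_equivalence (hom_graded k G) C (orbit_cat (smash_cat C)) (omega C).
Proof.
apply: fully_faithful_equivalence.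
- move=> x y p q e; exists (gcast (esym (deg_omega e))) => f /=;
    by rewrite gcast_cast gcast_id.
- (* The identity of x, as a morphism of degree - p from x^0 to x^p. *)
  move=> [x p]; exists x, (- p).
  have d : 0 = p + (- p) - 0 by Degree.solve.
  have d' : 0 = 0 + - - p - p by Degree.solve.
  exists (gcast d (gid x)), (gcast d' (gid x)).
  rewrite -!(hg_comp (addNr _)) -!(hg_comp (addrN _)).
  by split; congr hg; cast_solve.
Qed.

Lemma deg_omega_nat (a : G) : 0 = 0 + (a + 0 - (0 + 0)) - (0 + a).
Proof. Degree.solve. Qed.

(** Here (H#G)/G sends x^0 to (H x)^(gadj H x) with adjuster 0, while the other
    composite gives (H x)^0 with adjuster gadj H x; the identity of H x compares
    them with exactly the degree that the adjusters demand. *)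
Definition omega_nat (C1 C2 : grcat k G) (H : grfun C1 C2) :
  grnat (grfun_comp (orbit_grfun (smash_eqfun H)) (omega C1))
    (grfun_comp (omega C2) H).
Proof.
refine (@GrNat k G _ _
  (grfun_comp (orbit_grfun (smash_eqfun H)) (omega C1))
  (grfun_comp (omega C2) H)
  (fun x => gcast (deg_omega_nat (gadj H x)) (gid (H x))) _).
by move=> x y p pH pI r eH eI e1 e2 f; cast_solve.
Defined.

Lemma omega_nat_invertible (C1 C2 : grcat k G) (H : grfun C1 C2) :
  @invertible2 (hom_graded k G) _ _ _ _ (omega_nat H).
Proof.
have d (a : G) : 0 = 0 + a + (0 + 0 - (a + 0)) - 0 by Degree.solve.
by apply: (@grnat_invertible k G _ _
  (grfun_comp (orbit_grfun (smash_eqfun H)) (omega C1))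
  (grfun_comp (omega C2) H) _ (fun x => gcast (d (gadj H x)) (gid (H x))))
  => x e; cast_solve.
Qed.

Lemma omega_pseudonat : pseudonat_equivalent (pf_id (hom_graded k G))
  (pf_compose (orbit_2functor k G) (smash_2functor k G)).
Proof.
unshelve eexists.
- refine (@Pseudonat (hom_graded k G) (hom_graded k G) (pf_id _)
    (pf_compose (orbit_2functor k G) (smash_2functor k G))
    (fun C => omega C) (fun C1 C2 H => omega_nat H)
    (fun C1 C2 H => omega_nat_invertible H) _ _ _).
  + by move=> C1 C2 H I a; apply: grnat_eq => x; cast_solve.
  + by move=> C; apply: grnat_eq => x; cast_solve.
  + by move=> C1 C2 C3 I H; apply: grnat_eq => x; cast_solve.
- exact: omega_is_equivalence.
Qed.

End Omega.

(** * Linear forms and nondegenerate pairings *)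

Section Forms.
Variable k : fieldType.

Definition scalar_of (V : lmodType k) (f : V -> k) (h : scalar f) :
  {scalar V} := HB.pack f (GRing.isLinear.Build k V k *%R f h).

Lemma linear_scale (V W : lmodType k) (f : V -> W) : linear f ->
  forall a v, f (a *: v) = a *: f v.
Proof.
move=> h; pose F : {linear V -> W} :=
  HB.pack f (GRing.isLinear.Build k V W *:%R f h).
by move=> a v; exact: (linearZ_LR F).
Qed.

Lemma scalar_eq (V : lmodType k) (f g : {scalar V}) : f =1 g -> f = g.
Proof.
case: f g => [f [[f1] [f2]]] [g [[g1] [g2]]] /= /funext fg; subst g.
by rewrite (Prop_irrelevance f1 g1) (Prop_irrelevance f2 g2).
Qed.

Lemma inj_surj_bijective (T U : Type) (f : T -> U) : injective f ->
  (forall u, exists t, f t = u) -> bijective f.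
Proof.
move=> fI fS; exists (fun u => sval (cid (fS u))).
  by move=> t; apply: fI; exact: (svalP (cid (fS (f t)))).
by move=> u; exact: (svalP (cid (fS u))).
Qed.

(** Composing a perfect pairing with a linear bijection in one variable and with
    a nonzero scalar keeps it perfect. *)
Lemma twist_bijective (V W W' : lmodType k) (K : V -> {scalar W})
  (K' : V -> {scalar W'}) (L : W' -> W) (c : k) :
  linear L -> bijective L -> c != 0 ->
  (forall v w, K' v w = c * K v (L w)) -> bijective K -> bijective K'.
Proof.
move=> Llin [M LM ML] c0 K'E [J KJ JK]; apply: inj_surj_bijective.
  move=> v w /(congr1 (fun f : {scalar W'} => f : W' -> k)) vw.
  rewrite -[v]KJ -[w]KJ; congr J; apply: scalar_eq => u.
  apply: (mulfI c0); rewrite -[u]ML -!K'E; exact: (congr1 (@^~ (M u)) vw).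
move=> f; have Mlin : scalar (fun u => c^-1 * f (M u)).
  move=> a u v; have -> : M (a *: u + v) = a *: M u + M v.
    by rewrite -[RHS]LM Llin !ML.
  by rewrite linearP mulrDr mulrCA.
exists (J (scalar_of Mlin)); apply: scalar_eq => u.
by rewrite K'E JK /= LM mulrA divff // mul1r.
Qed.

(** K is a perfect pairing of V with W.  If W is finite-dimensional, the elements
    v i of V paired to the coordinate forms of W are a basis dual to w i, so every
    form on V is evaluation at the combination of the w i with coefficients
    f (v i). *)
Lemma form_representable (V W : lmodType k) (K : V -> {scalar W})
  (f : {scalar V}) : finite_dim W ->
  (forall a u v w, K (a *: u + v) w = a * K u w + K v w) -> bijective K ->
  exists w, forall v, f v = K v w.
Proof.
move=> [n [[r rlin [r' rr' r'r]]]] Klin [J KJ JK].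
have rowlin i : scalar (fun w => r w 0 i).
  by move=> a u v; rewrite rlin !mxE.
pose v i := J (scalar_of (rowlin i)).
have Kv i w : K (v i) w = r w 0 i by rewrite /v JK.
pose w i := r' (delta_mx 0 i).
have r'lin : linear r' by move=> a x y; rewrite -[RHS]rr' rlin !r'r.
pose R' : {linear 'rV[k]_n -> W} :=
  HB.pack r' (GRing.isLinear.Build k _ _ *:%R r' r'lin).
have wE u : u = \sum_i r u 0 i *: w i.
  have := congr1 R' (row_sum_delta (r u)); rewrite linear_sum /= rr' => {1}->.
  by apply: eq_bigr => i _; exact: (linearZ_LR R').
have Klin' u : linear_for *%R (fun x => K x u) by move=> a x y; exact: Klin.
pose Ku u : {scalar V} := scalar_of (Klin' u).
have vE x : x = \sum_i K x (w i) *: v i.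
  rewrite -[LHS]KJ -[RHS]KJ; congr J; apply: scalar_eq => u.
  rewrite -[RHS]/(Ku u _) linear_sum {1}(wE u) linear_sum.
  by apply: eq_bigr => i _; rewrite !linearZ /= Kv mulrC.
exists (\sum_i f (v i) *: w i) => x.
rewrite {1}(vE x) !linear_sum; apply: eq_bigr => i _.
by rewrite !linearZ /= mulrC.
Qed.

End Forms.

(** * Fully faithful functors *)

Section FullyFaithful.
Variable k : fieldType.

Lemma compZl (D : lincat k) (x y z : D) a (g : hom y z) (f : hom x y) :
  (a *: g) ∘ f = a *: (g ∘ f).
Proof. exact: (linear_scale (comp_linearl f)). Qed.

Lemma compZr (D : lincat k) (x y z : D) a (g : hom y z) (f : hom x y) :
  g ∘ (a *: f) = a *: (g ∘ f).
Proof. exact: (linear_scale (comp_linearr g)). Qed.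

Lemma fmorZ (D E : lincat k) (S : functor D E) (x y : D) a (f : hom x y) :
  fmor S (a *: f) = a *: fmor S f.
Proof. exact: (linear_scale (@fmor_linear _ _ _ S x y)). Qed.

Lemma is_isoZ (D : lincat k) (x y : D) a (f : hom x y) :
  a != 0 -> is_iso f -> is_iso (a *: f).
Proof.
move=> a0 [g [gf fg]]; exists (a^-1 *: g).
by rewrite !compZl !compZr !scalerA mulVf // mulfV // !scale1r.
Qed.

Lemma is_iso_eqm (D : lincat k) (x y : D) (e : x = y) : is_iso (eqm e).
Proof. by exists (eqm (esym e)); rewrite !eqmM !eqm_id. Qed.

Lemma iso_epi (D : lincat k) (x y z : D) (f : hom x y) (g h : hom y z) :
  is_iso f -> g ∘ f = h ∘ f -> g = h.
Proof.
by move=> [i [_ fi]] gh; rewrite -[g]compm1 -[h]compm1 -fi !compmA gh.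
Qed.

Lemma iso_mono (D : lincat k) (x y z : D) (f : hom y z) (g h : hom x y) :
  is_iso f -> f ∘ g = f ∘ h -> g = h.
Proof.
by move=> [i [iF _]] gh; rewrite -[g]comp1m -[h]comp1m -iF -!compmA gh.
Qed.

Lemma natisoP (C D : lincat k) (S T : functor C D) : natiso S T ->
  exists (a : forall x, hom (S x) (T x)) (b : forall x, hom (T x) (S x)),
    [/\ forall x, b x ∘ a x = idm _, forall x, a x ∘ b x = idm _
      & forall x y (f : hom x y), a y ∘ fmor S f = fmor T f ∘ a x].
Proof.
move=> [a ia]; exists a, (fun x => projT1 (cid (ia x))).
by split=> [x|x|x y f]; [exact: (projT2 (cid (ia x))).1
  | exact: (projT2 (cid (ia x))).2 | exact: nt_nat].
Qed.

Lemma natiso_sym (C D : lincat k) (S T : functor C D) :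
  natiso S T -> natiso T S.
Proof.
move=> /natisoP [a [b [ba ab an]]].
have bn x y (f : hom x y) : b y ∘ fmor T f = fmor S f ∘ b x.
  rewrite -[LHS]compm1 -(ab x) !compmA -(compmA (b y)) -an.
  by rewrite !compmA ba comp1m.
by exists (NatTrans bn) => x; exists (a x).
Qed.

Lemma natiso_eq (C D : lincat k) (S T : functor C D) : S = T -> natiso S T.
Proof.
move=> ST; exists (NatTrans (fun x y f => eqm_feq_nat ST f)) => x.
exact: is_iso_eqm.
Qed.

Definition fully_faithful (C D : lincat k) (S : functor C D) :=
  forall x y, bijective (@fmor _ _ _ S x y).

Lemma retraction_faithful (C D : lincat k) (S : functor C D)
  (T : functor D C) : natiso (fid C) (fcomp T S) ->
  forall x y, injective (@fmor _ _ _ S x y).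
Proof.
move=> [a ia] x y f g fg; apply: (iso_mono (ia y)).
by rewrite (nt_nat a f) (nt_nat a g) /= fg.
Qed.

Lemma autoequivalence_fully_faithful (D : lincat k) (S : functor D D) :
  is_autoequivalence S -> fully_faithful S.
Proof.
move=> [T [TS ST]] x y; apply: inj_surj_bijective.
  exact: (retraction_faithful TS).
have /natisoP [a [b [ba ab an]]] := TS.
move=> g; exists (b y ∘ fmor T g ∘ a x).
apply: (retraction_faithful (natiso_sym ST)).
apply: (iso_epi (ex_intro _ _ (conj (ba x) (ab x)))).
have /= <- := an _ _ (b y ∘ fmor T g ∘ a x).
by rewrite !compmA ab comp1m.
Qed.

Lemma fully_faithful_comp (B C D : lincat k) (S : functor C D)
  (T : functor B C) :
  fully_faithful S -> fully_faithful T -> fully_faithful (fcomp S T).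
Proof. by move=> Sff Tff x y; exact: bij_comp (Sff _ _) (Tff x y). Qed.

Lemma automorphism_fully_faithful (D : lincat k) (E : automorphism D) :
  fully_faithful E.
Proof.
apply: autoequivalence_fully_faithful; exists (autV E).
by split; apply: natiso_eq; [rewrite autK | rewrite autVK].
Qed.

Lemma automorphism_onto (D : lincat k) (E : automorphism D) (y : D) :
  exists x, E x = y.
Proof. by exists (autV E y); exact: (feq_ob (autVK E) y). Qed.

End FullyFaithful.

(** * Compatibility isomorphisms of a Serre functor with automorphisms *)

Section Zeta.
Variables (k : fieldType) (D : lincat k) (S : serre D).

(** The identity that characterises zeta, read on e = T f and transported along T,
    so that no inverse of T and no comparison morphism appears.  It makes sense
    for any functor T, and is stable under composition of fully faithful
    functors. *)
Definition zeta_compat (T : functor D D) (z : forall y, hom (S (T y)) (T (S y))) :=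
  forall x y (f : hom y x) (v : hom x (S y)) (u : hom (T x) (S (T y))),
    fmor T v = z y ∘ u -> serre_kappa S (fmor T f) u = serre_kappa S f v.

(** Coordinates on the finite-dimensional space D(y, S x) are linear forms, hence
    of the form kappa f. *)
Lemma kappa_separates (x y : D) (u v : hom y (S x)) :
  (forall f : hom x y, serre_kappa S f u = serre_kappa S f v) -> u = v.
Proof.
move=> uv; have [K KJ JK] := serre_kappa_bij S x y.
have [n [[r rlin [r' rr' r'r]]]] := serre_finite S y (S x).
rewrite -[u]rr' -[v]rr'; congr r'; apply/rowP => i.
have rowlin : scalar (fun w => r w 0 i).
  by move=> a s t; rewrite rlin !mxE.
by have := uv (K (scalar_of rowlin)); rewrite JK.
Qed.

Lemma is_zeta_compat (E : automorphism D) (z : nattrans (fcomp S E) (fcomp E S)) :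
  is_zeta z -> zeta_compat z.
Proof.
move=> h x y f v u uv; rewrite h -uv.
have := eqm_feq_nat (esym (autK E)) f; have := eqm_feq_nat (autK E) v.
rewrite /= => nv nf.
rewrite (eqm_irr (autobK E (S y)) (feq_ob (autK E) (S y))) nv.
rewrite (eqm_irr (esym (autobK E y)) (feq_ob (esym (autK E)) y)) -nf.
by rewrite serre_kappal -compmA eqmM eqm_id compm1.
Qed.

(** Postcomposition with z y is injective because kappa separates morphisms.  A
    right inverse represents the form e |-> kappa (E^-1 e) (id) on
    D(E y, E (S y)). *)
Lemma zeta_compat_iso (E : automorphism D) (z : forall y, hom (S (E y)) (E (S y))) :
  zeta_compat z -> forall y, is_iso (z y).
Proof.
move=> zP y; have full x w (g : hom (E x) (E w)) : exists f, fmor E f = g.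
  by case: (automorphism_fully_faithful E x w) => h _ hK; exists (h g).
have zinj w (a b : hom w (S (E y))) : z y ∘ a = z y ∘ b -> a = b.
  have [x xw] := automorphism_onto E w; subst w => ab.
  have [v zv] := full _ _ (z y ∘ a).
  apply: kappa_separates => e; have [f <-] := full _ _ e.
  by rewrite (zP _ _ f v a zv) (zP _ _ f v b) // zv.
have [i zi] : exists i, z y ∘ i = idm (E (S y)).
  have [J EJ JE] := automorphism_fully_faithful E y (S y).
  have Jlin : linear J.
    by move=> a f g; rewrite -[RHS]EJ fmor_linear !JE.
  have Klin : scalar (fun e : hom (E y) (E (S y)) => serre_kappa S (J e) (idm _)).
    by move=> a f g; rewrite Jlin serre_kappa_linear.
  have [i iE] := form_representable (scalar_of Klin) (serre_finite S _ _)
    (fun a f g u => serre_kappa_linear (s := S) a f g u)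
    (serre_kappa_bij S (E y) (E (S y))).
  exists i; have [v vE] := full _ _ (z y ∘ i); rewrite -vE -(fmor1 E).
  congr fmor; apply: kappa_separates => f.
  by rewrite -(zP _ _ f v i vE) -iE /= EJ.
exists i; split=> //; apply: zinj.
by rewrite compmA zi comp1m compm1.
Qed.

(** The inverses of z y and z' y pair in the same way with every morphism, which
    by fullness may be taken of the form T f. *)
Lemma zeta_compat_unique (T : functor D D)
  (z z' : forall y, hom (S (T y)) (T (S y))) :
  fully_faithful T -> zeta_compat z -> zeta_compat z' ->
  (forall y, is_iso (z y)) -> (forall y, is_iso (z' y)) ->
  forall y, z y = z' y.
Proof.
move=> Tff zP z'P zi z'i y; have [i [iz zI]] := zi y; have [j [jz zJ]] := z'i y.
have ij : i = j.
  apply: kappa_separates => e; have [J _ JK] := Tff y (S y).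
  rewrite -[e]JK (zP _ _ (J e) (idm _) i) ?fmor1 //.
  by rewrite (z'P _ _ (J e) (idm _) j) ?fmor1.
by rewrite -[LHS]comp1m -zJ -ij -compmA iz compm1.
Qed.

(** Since T is full, z (T' y) ∘ u is the image under T of a morphism, and the
    compatibility of z' applies to the latter. *)
Lemma zeta_compat_comp (T T' : functor D D) z z' :
  fully_faithful T -> fully_faithful T' ->
  @zeta_compat T z -> @zeta_compat T' z' ->
  @zeta_compat (fcomp T T') (fun y => fmor T (z' y) ∘ z (T' y)).
Proof.
move=> Tff T'ff zP z'P x y f v u uv.
have [J TJ JT] := Tff (T' x) (S (T' y)).
have e : fmor T (J (z (T' y) ∘ u)) = z (T' y) ∘ u by rewrite JT.
rewrite (zP _ _ _ _ _ e); apply: z'P; apply: (bij_inj (Tff _ _)).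
by rewrite fmorM e compmA -uv.
Qed.

Lemma zeta_compat_eq (T T' : functor D D) (e : T = T') z :
  @zeta_compat T z -> @zeta_compat T' (fun y =>
    eqm (feq_ob e (S y)) ∘ z y ∘ fmor S (eqm (esym (feq_ob e y)))).
Proof.
subst T' => zP x y f v u uv; apply: zP; rewrite uv /= fmor1 compm1 comp1m //.
Qed.

End Zeta.

(** * The Serre structure of an orbit category *)

Section OrbitSerre.
Variables (k : fieldType) (G : zmodType) (X : character k G).
Variables (D : eqcat k G) (S : eqserre X D).

Lemma eqserre_s_iso p x : is_iso (eqserre_s S p x).
Proof.
have [z [zP ->]] := eqserre_zeta S p.
by apply: is_isoZ; [exact: chi_neq0 | exact: zeta_compat_iso (is_zeta_compat zP) _].
Qed.

(** Both sides are chi (p + q) times an isomorphism compatible with kappa over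
    the composite of F^p and F^q, and such an isomorphism is unique. *)
Lemma eqserre_s_add p q x :
  eqm (feq_ob (actD D p q) (S x)) ∘ eqserre_s S (p + q) x
  = fmor (eact D p) (eqserre_s S q x) ∘ eqserre_s S p (eact D q x)
    ∘ fmor S (eqm (feq_ob (actD D p q) x)).
Proof.
have [z [zP zE]] := eqserre_zeta S p; have [z' [z'P z'E]] := eqserre_zeta S q.
have [w [wP wE]] := eqserre_zeta S (p + q).
rewrite zE z'E wE fmorZ !compZl !compZr !compZl scalerA -(mulrC (X p)) -chiD.
congr (_ *: _).
have ff r : fully_faithful (eact D r) := automorphism_fully_faithful _.
have iso r (u : nattrans (fcomp S (eact D r)) (fcomp (eact D r) S)) y :
    is_zeta u -> is_iso (u y).
  by move=> uP; exact: zeta_compat_iso (is_zeta_compat uP) _.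
have <- := zeta_compat_unique (fully_faithful_comp (ff p) (ff q))
  (zeta_compat_eq (e := actD D p q) (is_zeta_compat wP))
  (zeta_compat_comp (ff p) (ff q) (is_zeta_compat zP) (is_zeta_compat z'P)) _ _ x.
- by rewrite -!compmA -fmorM eqmM eqm_id fmor1 compm1.
- move=> y; apply: is_iso_comp; last exact/is_iso_fmor/is_iso_eqm.
  by apply: is_iso_comp (iso _ _ _ wP); exact: is_iso_eqm.
- move=> y; apply: is_iso_comp (iso _ _ _ zP).
  exact: is_iso_fmor (iso _ _ _ z'P).
Qed.

Definition serre_eqfun : eqfun D D :=
  @EqFun k G D D S (eqserre_s S) eqserre_s_iso eqserre_s_add.

Lemma serre_eqfun_orbit_equivalence :
  @is_equivalence (hom_graded k G) _ _ (orbit_grfun serre_eqfun).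
Proof.
apply: fully_faithful_equivalence => [x y p q e|y].
- have [J SJ JS] := autoequivalence_fully_faithful (serre_equiv S) x (eact D p y).
  have [i [iM Mi]] : is_iso (eqm (act_irr (deg_zero e) (S y)) ∘ eqserre_s S p y).
    by apply: is_iso_comp (eqserre_s_iso _ _); exact: is_iso_eqm.
  exists (fun g => J (i ∘ g)) => f /=.
    by rewrite !compmA -(compmA i) iM comp1m SJ.
  by rewrite JS !compmA Mi comp1m.
have [T [_ /natisoP [a [b [ba ab _]]]]] := serre_equiv S.
have d : 0 = - 0 :> G by rewrite oppr0.
exists (T y), 0, (eqm (act_zero erefl y) ∘ a y),
  (eqm (act_zero d (S (T y))) ∘ b y).
split; [rewrite -(hg_comp (addrN _)) | rewrite -(hg_comp (addNr _))];
  congr hg; act_normalize; rewrite -compmA ?ba ?ab compm1; exact: eqm_irr.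
Qed.

Definition act_cancel (p q : G) (e : p + q = 0) (x : D) :
    eact D p (eact D q x) = x :=
  etrans (act_comp e x) (esym (act_one x)).

Lemma act_cancel_nat (p q : G) (e : p + q = 0) (x y : D) (f : hom x y) :
  f ∘ eqm (act_cancel e x)
  = eqm (act_cancel e y) ∘ fmor (eact D p) (fmor (eact D q) f).
Proof.
apply: (iso_mono (is_iso_eqm (act_one y))).
rewrite !compmA act_one_nat -compmA !eqmM (eqm_irr _ (act_comp e x)).
by rewrite (eqm_irr (etrans _ _) (act_comp e y)) act_comp_nat.
Qed.

Lemma deg_kappa (p : G) : p + (0 - p) = 0.
Proof. Degree.solve. Qed.

(** The morphisms of degree - p from y to S x in D/G form D(y, F^(-p) S x), which
    F^p carries onto D(F^p y, S x), paired by kappa with D(x, F^p y). *)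
Definition orbit_pairing x y p (u : hom y (eact D (0 - p) (S x))) :
  hom (eact D p y) (S x) :=
  eqm (act_cancel (deg_kappa p) (S x)) ∘ fmor (eact D p) u.

Lemma orbit_pairing_linear x y p : linear (@orbit_pairing x y p).
Proof. by move=> a u v; rewrite /orbit_pairing fmor_linear comp_linearr. Qed.

Lemma orbit_pairing_bijective x y p : bijective (@orbit_pairing x y p).
Proof.
have [J EJ JE] := automorphism_fully_faithful (eact D p) y (eact D (0 - p) (S x)).
exists (fun v => J (eqm (esym (act_cancel (deg_kappa p) (S x))) ∘ v)) => u.
  by rewrite /orbit_pairing compmA eqmM eqm_id comp1m EJ.
by rewrite /orbit_pairing JE compmA eqmM eqm_id comp1m.
Qed.

Lemma orbit_kappa_scalar x y p (f : hom x (eact D p y)) :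
  scalar (fun u : hom y (eact D (0 - p) (S x)) =>
    X p * serre_kappa S f (orbit_pairing u)).
Proof.
by move=> a u v; rewrite orbit_pairing_linear linearP mulrDr mulrCA.
Qed.

(** The left rule moves h of degree q across kappa and changes the scalar from
    chi (p + q) to chi p, whence the factor chi q.  In the right rule the
    missing chi p comes from s^p = chi p *: zeta, after zeta has turned the
    pairing with F^p g into the pairing with g. *)
Definition orbit_grserre : grserre X (orbit_cat D).
Proof.
refine (@GrSerre k G X (orbit_cat D) (orbit_grfun serre_eqfun)
  serre_eqfun_orbit_equivalence _
  (fun x y p f => scalar_of (orbit_kappa_scalar f)) _ _ _ _).
- by move=> x y p; exact: serre_finite S _ _.
- move=> x y p a f g u; rewrite /= serre_kappa_linear mulrDr mulrCA //.
- move=> x y p.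
  refine (@twist_bijective k (hom x (eact D p y)) (hom (eact D p y) (S x))
    (hom y (eact D (0 - p) (S x))) (@serre_kappa k D S x (eact D p y))
    (fun f => scalar_of (orbit_kappa_scalar f))
    (@orbit_pairing x y p) (X p) (@orbit_pairing_linear x y p)
    (orbit_pairing_bijective x y p) (chi_neq0 X p) (fun f u => erefl)
    (serre_kappa_bij S x (eact D p y))).
- move=> x y z p q r e e' h g u; rewrite /=.
  have -> : X r = X q * X p by rewrite -e chiD mulrC.
  rewrite mulrA serre_kappal; congr (_ * serre_kappa S g _).
  by rewrite /orbit_pairing; act_solve.
- move=> w x y p q r s e es e' g f u; rewrite /=.
  have [z [zP zE]] := eqserre_zeta S p.
  have -> : X r = X q * X p by rewrite -e chiD mulrC.
  rewrite -mulrA zE; congr (_ * _).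
  rewrite /orbit_pairing !(compZl, compZr, fmorZ) linearZ /=; congr (_ * _).
  rewrite (serre_kappar (s := S) (eqm (act_comp e y) ∘ fmor (eact D p) g) f).
  rewrite serre_kappal; apply: (is_zeta_compat zP).
  by rewrite !compmA act_cancel_nat; act_solve.
Defined.

Lemma orbit_admits_grserre : admits_grserre X (orbit_cat D).
Proof. exact: inhabits orbit_grserre. Qed.

End OrbitSerre.

(** * The Serre structure of a smash product *)

Section SmashSerre.
Variables (k : fieldType) (G : zmodType) (X : character k G).

Lemma equivariant_autoequivalence (D : eqcat k G) (S : eqfun D D) :
  @is_equivalence (equivariant k G) D D S -> is_autoequivalence S.
Proof.
have iso (T U : eqfun D D) (a : @cell2 (equivariant k G) D D T U) :
    invertible2 a -> natiso T U.
  move=> [b [ba ab]]; exists (eqn a) => x; exists (b x); split.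
    exact: (congr1 (fun c : eqnat T T => c x) ba).
  exact: (congr1 (fun c : eqnat U U => c x) ab).
by move=> [T [[a ia] [b ib]]]; exists T; split; [exact: iso ia | exact: iso ib].
Qed.

Variables (C : grcat k G) (S : grserre X C).

Lemma smash_serre_autoequivalence : is_autoequivalence (smash_fun S).
Proof.
apply: (@equivariant_autoequivalence (smash_cat C) (smash_eqfun S)).
exact: (pf1_is_equivalence (smash_2functor k G) (grserre_equiv S)).
Qed.

Lemma deg_smash_kappa (p q a : G) : p + a - q = a - (q - p).
Proof. Degree.solve. Qed.

Lemma smash_kappa_scalar (x y : smash_lincat C) (f : hom x y) :
  scalar (fun u : hom y (smash_fun S x) => (X y.2)^-1 *
    grserre_kappa S f (gcast (deg_smash_kappa x.2 y.2 (gadj S x.1)) u)).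
Proof. by move=> a u v; rewrite gcast_linear linearP mulrDr mulrCA. Qed.

(** The factor chi (q)^-1, with q the label of the target y^q, removes the
    character from the left rule; the right rule keeps the target fixed. *)
Definition smash_serre : serre (smash_lincat C).
Proof.
refine (@Serre k (smash_lincat C) (smash_fun S) smash_serre_autoequivalence _
  (fun x y f => scalar_of (smash_kappa_scalar f)) _ _ _ _).
- by move=> x y; exact: grserre_finite S _ _ _.
- by move=> x y a f g u; rewrite /= grserre_kappa_linear mulrDr mulrCA.
- move=> x y.
  refine (@twist_bijective k (ghom x.1 y.1 (y.2 - x.2))
    (ghom y.1 (S x.1) (gadj S x.1 - (y.2 - x.2)))
    (ghom y.1 (S x.1) (x.2 + gadj S x.1 - y.2))
    (@grserre_kappa k G X C S x.1 y.1 (y.2 - x.2))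
    (fun f => scalar_of (smash_kappa_scalar f))
    (gcast (deg_smash_kappa x.2 y.2 (gadj S x.1))) (X y.2)^-1
    (@gcast_linear _ _ _ _ _ _ _ _) _ _ (fun f u => erefl)
    (grserre_kappa_bij S x.1 y.1 _)).
    exists (gcast (esym (deg_smash_kappa x.2 y.2 (gadj S x.1)))) => u;
    by rewrite gcast_cast gcast_id.
  by rewrite invr_eq0 chi_neq0.
- move=> x y z h g u; rewrite /=.
  have d : z.2 - y.2 + (gadj S x.1 - (z.2 - x.2))
    = gadj S x.1 - (y.2 - x.2) by Degree.solve.
  rewrite (grserre_kappal (deg_smash_comp x.2 y.2 z.2) d) mulrA; congr (_ * _).
    have -> : X z.2 = X (z.2 - y.2) * X y.2 by rewrite -chiD subrK.
    by rewrite invfM mulrAC mulVf ?mul1r ?chi_neq0.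
  congr (grserre_kappa S g _); cast_solve.
- move=> w x y g f u; rewrite /=; congr (_ * _).
  have d : gadj S w.1 - (y.2 - w.2)
      + (x.2 + gadj S x.1 - (w.2 + gadj S w.1))
    = gadj S x.1 - (y.2 - x.2) by Degree.solve.
  rewrite (grserre_kappar (deg_smash_comp w.2 x.2 y.2)
    (deg_smash_mor _ _ _ _) d); congr (grserre_kappa S g _).
  cast_solve.
Defined.

Lemma nattrans_scale (D E : lincat k) (T U : functor D E) (a : k)
  (n : nattrans T U) x y (f : hom x y) :
  (a *: n y) ∘ fmor T f = fmor U f ∘ (a *: n x).
Proof. by rewrite compZl compZr nt_nat. Qed.

Lemma grserre_kappa_cast (x y : C) (p p' d : G) (a : p = p')
  (b : d = gadj S x - p') (b' : d = gadj S x - p) (f : ghom x y p)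
  (u : ghom y (S x) d) :
  grserre_kappa S (gcast a f) (gcast b u) = grserre_kappa S f (gcast b' u).
Proof.
by subst p'; rewrite gcast_id; congr (grserre_kappa S f _); exact: gcast_irr.
Qed.

(** Shifting by r multiplies the factor chi (q)^-1 of the pairing by chi (r)^-1.
    This is the scalar by which zeta differs from the identity, so that
    chi (r) *: zeta is the strict equivariance of S#G. *)
Definition smash_eqserre : eqserre X (smash_cat C).
Proof.
refine (@EqSerre k G X (smash_cat C) smash_serre (fun r => smash_strict S r) _).
move=> r; exists (NatTrans (nattrans_scale (X r)^-1 (smash_strict S r))); split.
  move=> [x p] [y q] e u; rewrite compZl fmorZ compZr linearZ; cast_normalize.
  have -> : X p = X (p - r) * X r by rewrite -chiD subrK.
  rewrite invfM mulrA (mulrC (X r)^-1); congr (_ * _).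
  by apply: esym; exact: grserre_kappa_cast.
by move=> x; rewrite /= scalerA mulfV ?scale1r ?chi_neq0.
Defined.

Lemma smash_admits_eqserre : admits_eqserre X (smash_cat C).
Proof. exact: inhabits smash_eqserre. Qed.

End SmashSerre.

Theorem theorem4p35 (k : fieldType) (G : zmodType) (X : character k G) :
  quasi_inverse_biequivalences (orbit_2functor k G) (smash_2functor k G) /\
  exists (ho : orbit_preserves_serre X) (hs : smash_preserves_serre X),
    quasi_inverse_biequivalences (serre_orbit ho) (serre_smash hs).
Proof.
split; first by split; [exact: eta_pseudonat | exact: omega_pseudonat].
have ho : orbit_preserves_serre X by move=> D [S]; exact: orbit_admits_grserre.
have hs : smash_preserves_serre X by move=> C [S]; exact: smash_admits_eqserre.
exists ho, hs; split.
  exact: (@pseudonat_equivalent_full (max_2groupoid (equivariant k G))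
    (max_2groupoid (hom_graded k G)) (@admits_eqserre k G X)
    (@admits_grserre k G X) (pf_max (orbit_2functor k G))
    (pf_max (smash_2functor k G)) ho hs
    (pseudonat_equivalent_max (eta_pseudonat k G))).
exact: (@pseudonat_equivalent_full (max_2groupoid (hom_graded k G))
  (max_2groupoid (equivariant k G)) (@admits_grserre k G X)
  (@admits_eqserre k G X) (pf_max (smash_2functor k G))
  (pf_max (orbit_2functor k G)) hs ho
  (pseudonat_equivalent_max (omega_pseudonat k G))).
Qed.
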